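(* Let $\alpha\in(1,2)$, $0<\lambda<\Lambda$, and let $K_-,K_+\subset(\lambda,\Lambda)$ be nonempty bounded measurable sets. Let $(X_t)_{t\ge 0}$ be the nonlinear $\alpha$-stable Lévy process associated with $K_\pm$ (see context), with sublinear expectation $\mathcal{E}$. Let $(Y_i)_{i=1}^\infty$ be a sequence of random variables on a sublinear expectation space with sublinear expectation $\mathcal{E}'$, i.i.d. in the sense that for all $i\ge 1$, $Y_{i+1}$ is independent from $(Y_1,\dots,Y_i)$ and $Y_{i+1}\sim Y_i$. Let $b>0$, $B_n=\frac{1}{b\,n^{1/\alpha}}$ and $S_n=\sum_{i=1}^n Y_i$. Suppose that (i) $\mathcal{E}'[Y_1]=\mathcal{E}'[-Y_1]=0$; (ii) $\mathcal{E}'[|Y_1|]<\infty$; and (iii) for any $0<h<1$ and any $\psi\in C_{\mathrm{b.Lip}}(\mathbb{R})$, $$ n\left|\mathcal{E}'\big[\delta_{B_nY_1}v(t,x)\big]-\frac1n\sup_{k_\pm\in K_\pm}\left\{\int_{\mathbb{R}}\delta_z v(t,x)\,F_{k_\pm}(dz)\right\}\right|\to 0 $$ uniformly in $(t,x)\in[0,1]\times\mathbb{R}$ as $n\to\infty$, where $v$ is the unique viscosity solution of $$\partial_t v(t,x)+\sup_{k_\pm\in K_\pm}\left\{\int_{\mathbb{R}}\delta_z v(t,x)\,F_{k_\pm}(dz)\right\}=0,\quad (t,x)\in(-h,1+h)\times\mathbb{R},$$ $$v(1+h,x)=\psi(x),\quad x\in\mathbb{R}.$$ Then $B_nS_n\xrightarrow{d}X_1$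 as $n\to\infty$, that is, $\lim_{n\to\infty}\mathcal{E}'[\psi(B_nS_n)]=\mathcal{E}[\psi(X_1)]$ for all $\psi\in C_{\mathrm{b.Lip}}(\mathbb{R})$.
   Context: **Sublinear expectations.** $C_{\mathrm{b.Lip}}(\mathbb{R}^n)$ is the set of bounded Lipschitz functions on $\mathbb{R}^n$. Let $\mathcal{H}$ be a collection of real-valued functions on a set $\Omega$ (the random variables). A sublinear expectation is a map $\mathcal{E}:\mathcal{H}\to\mathbb{R}$ which is monotonic ($\mathcal{E}[X]\le\mathcal{E}[Y]$ if $X\le Y$), constant-preserving ($\mathcal{E}[c]=c$ for $c\in\mathbb{R}$), sub-additive ($\mathcal{E}[X+Y]\le\mathcal{E}[X]+\mathcal{E}[Y]$) and positively homogeneous ($\mathcal{E}[\lambda X]=\lambda\mathcal{E}[X]$ for $\lambda\ge0$). $(\Omega,\mathcal{H},\mathcal{E})$ is called a sublinear expectation space. It is assumed that $\mathcal{H}$ is a linear space, contains the constants, and contains $\psi(X_1,\dots,X_n)$ for all $X_1,\dots,X_n\in\mathcal{H}$, $\psi\in C_{\mathrm{b.Lip}}(\mathbb{R}^n)$; any random variable whose expectation is written is understood to belong to $\mathcal{H}$. $X$ and $Y$ are identically distributed, $X\sim Y$, if $\mathcal{E}[\psi(X)]=\mathcal{E}[\psi(Y)]$ for all $\psi\in C_{\mathrm{b.Lip}}(\mathbb{R})$ (with each side computed under its own sublinear expectation if the spaces differ). $Y$ is independent from a random vector $X=(X_1,\dots,X_m)$ if $\mathcal{E}[\psi(X,Y)]=\mathcal{E}\big[\mathcal{E}[\psi(x,Y)]_{x=X}\big]$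 for all $\psi\in C_{\mathrm{b.Lip}}(\mathbb{R}^{m+1})$ (this relation need not be symmetric). **Notation.** For $k_-\in K_-$, $k_+\in K_+$ (abbreviated $k_\pm\in K_\pm$), $F_{k_\pm}$ is the $\alpha$-stable Lévy measure $$F_{k_\pm}(dz)=\big(k_-\mathbf 1_{(-\infty,0)}(z)+k_+\mathbf 1_{(0,\infty)}(z)\big)|z|^{-\alpha-1}\,dz .$$ For a function $w(t,x)$, $\delta_z w(t,x):=w(t,x+z)-w(t,x)-\partial_xw(t,x)\,z$. **The process.** $(X_t)_{t\ge0}$ is the nonlinear Lévy process (constructed by Neufeld and Nutz) whose local characteristics are described by the set of Lévy triplets $\{(0,0,F_{k_\pm}):k_\pm\in K_\pm\}$: it is a real-valued càdlàg process on a sublinear expectation space with expectation $\mathcal{E}$, with $X_0=0$, stationary increments ($X_t-X_s\sim X_{t-s}$ for $0\le s\le t$), independent increments ($X_t-X_s$ is independent from $(X_{s_1},\dots,X_{s_n})$ for $0\le s_1\le\dots\le s_n\le s\le t$), and such that for each $\psi\in C_{\mathrm{b.Lip}}(\mathbb{R})$ the function $u(t,x)=\mathcal{E}[\psi(x+X_t)]$, $(t,x)\in[0,\infty)\times\mathbb{R}$, is the unique viscosity solution of $$\partial_tu(t,x)-\sup_{k_\pm\in K_\pm}\Big\{\int_{\mathbb{R}}\delta_zu(t,x)F_{k_\pm}(dz)\Big\}=0\ \text{ on }(0,\infty)\times\mathbb{R},\qquad u(0,x)=\psi(x).\quad( * )$$ **Viscosity solutions.** Let $C_b^{2,3}((0,\infty)\times\mathbb{R})$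 be the functions on $(0,\infty)\times\mathbb{R}$ having bounded continuous partial derivatives up to second order in $t$ and third order in $x$. A bounded upper semicontinuous $u$ on $[0,\infty)\times\mathbb{R}$ is a viscosity subsolution of $( * )$ if $u(0,\cdot)\le\psi$ and, for every $(t,x)\in(0,\infty)\times\mathbb{R}$ and every $\varphi\in C_b^{2,3}((0,\infty)\times\mathbb{R})$ with $\varphi\ge u$ on $(0,\infty)\times\mathbb{R}$ and $\varphi(t,x)=u(t,x)$, one has $\partial_t\varphi(t,x)-\sup_{k_\pm\in K_\pm}\{\int\delta_z\varphi(t,x)F_{k_\pm}(dz)\}\le0$. Supersolutions are defined by reversing the inequalities and the semicontinuity; a bounded continuous function that is both is a viscosity solution. Viscosity solutions of the backward equation for $v$ are defined analogously (time reversal); its unique viscosity solution is $v(t,x)=u(1+h-t,x)$ for $(t,x)\in(-h,1+h]\times\mathbb{R}$, with $u$ the solution of $( * )$ for the same $\psi$. *)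

(* Defs.v *)
From HB Require Import structures.
From mathcomp Require Import all_boot all_order all_algebra.
From mathcomp Require Import all_classical all_reals all_analysis.
Set Implicit Arguments.
Unset Strict Implicit.
Unset Printing Implicit Defensive.
Import Order.TTheory GRing.Theory Num.Theory.
Import numFieldNormedType.Exports.
Local Open Scope classical_set_scope.
Local Open Scope ring_scope.

(* The norm on ['rV[R]_n] is the sup norm; all norms on R^n give the same
   bounded Lipschitz functions. *)
Definition CbLip (R : realType) (V : normedModType R) (f : V -> R) : Prop :=
  bounded_fun f /\ lipschitz f.

(* [sE] is a total function, but it is only constrained on [sH]: its values
   outside [sH] are meaningless. *)
Record sublinear_space (R : realType) := SublinearSpace {
  sOmega : Type;
  sH : set (sOmega -> R);
  sE : (sOmega -> R) -> R;
  sH_cst : forall c : R, sH (fun=> c);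
  sH_add : forall X Y, sH X -> sH Y -> sH (fun w => X w + Y w);
  sH_scale : forall (a : R) X, sH X -> sH (fun w => a * X w);
  sH_CbLip : forall (n : nat) (X : 'I_n -> sOmega -> R) (psi : 'rV[R]_n -> R),
    (forall i, sH (X i)) -> CbLip psi -> sH (fun w => psi (\row_i X i w));
  sE_mono : forall X Y, sH X -> sH Y -> (forall w, X w <= Y w) -> sE X <= sE Y;
  sE_cst : forall c : R, sE (fun=> c) = c;
  sE_subadd : forall X Y, sH X -> sH Y ->
    sE (fun w => X w + Y w) <= sE X + sE Y;
  sE_poshom : forall (a : R) X, 0 <= a -> sH X ->
    sE (fun w => a * X w) = a * sE X
}.

Definition identically_distributed (R : realType) (S1 S2 : sublinear_space R)
    (X : sOmega S1 -> R) (Y : sOmega S2 -> R) : Prop :=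
  forall psi : R -> R, CbLip psi ->
    sE (fun w => psi (X w)) = sE (fun w => psi (Y w)).

(* [Y] is independent from [X = (X_0, ..., X_(m-1))]; not symmetric. *)
Definition independent_from (R : realType) (S : sublinear_space R) (m : nat)
    (X : 'I_m -> sOmega S -> R) (Y : sOmega S -> R) : Prop :=
  forall psi : 'rV[R]_(m + 1) -> R, CbLip psi ->
    sE (fun w => psi (row_mx (\row_i X i w) (const_mx (Y w)))) =
    sE (fun w => sE (fun w' => psi (row_mx (\row_i X i w) (const_mx (Y w'))))).

Definition levy_density (R : realType) (alpha km kp z : R) : R :=
  (km * \1_(`]-oo, 0[%classic : set R) z +
   kp * \1_(`]0, +oo[%classic : set R) z) * `|z| `^ (- alpha - 1).

(* delta_z w(t, x) for f = w(t, .).  [derive1] is total, with an unspecified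
   value where f is not differentiable. *)
Definition delta (R : realType) (f : R -> R) (x z : R) : R :=
  f (x + z) - f x - derive1 f x * z.

(* Integral of z |-> delta_z f(x) against F_k(dz), in the extended reals. *)
Definition levy_integral (R : realType) (alpha km kp : R) (f : R -> R) (x : R) :
    \bar R :=
  (\int[@lebesgue_measure R]_(z in [set: R])
     (delta f x z * levy_density alpha km kp z)%:E)%E.

Definition levy_sup (R : realType) (alpha : R) (Km Kp : set R) (f : R -> R)
    (x : R) : \bar R :=
  ereal_sup [set levy_integral alpha k.1 k.2 f x | k in Km `*` Kp].

Definition unc (R : realType) (u : R -> R -> R) (p : R * R) : R := u p.1 p.2.

Definition dt (R : realType) (i : nat) (u : R -> R -> R) (t x : R) : R :=
  derive1n i (fun s => u s x) t.

Definition dx (R : realType) (j : nat) (u : R -> R -> R) (t x : R) : R :=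
  derive1n j (u t) x.

Definition bounded_continuous_on (R : realType) (D : set (R * R))
    (u : R -> R -> R) : Prop :=
  {within D, continuous (unc u)} /\ [bounded unc u p | p in D].

(* C_b^{2,3}(I x R), for an open set of times I: the pure partial derivatives
   up to order 2 in t and order 3 in x (including order 0) exist, and are
   bounded and continuous; no condition on mixed derivatives. *)
Definition Cb23 (R : realType) (I : set R) (phi : R -> R -> R) : Prop :=
  [/\ forall i t x, (i < 2)%N -> I t -> derivable (fun s => dt i phi s x) t 1,
      forall j t x, (j < 3)%N -> I t -> derivable (dx j phi t) x 1,
      forall i, (i <= 2)%N -> bounded_continuous_on (I `*` setT) (dt i phi) &
      forall j, (j <= 3)%N -> bounded_continuous_on (I `*` setT) (dx j phi)].

Definition usc_on (R : realType) (D : set (R * R)) (u : R -> R -> R) : Prop :=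
  forall p a, D p -> unc u p < a ->
    \forall q \near within D (nbhs p), unc u q < a.

Definition lsc_on (R : realType) (D : set (R * R)) (u : R -> R -> R) : Prop :=
  forall p a, D p -> a < unc u p ->
    \forall q \near within D (nbhs p), a < unc u q.

(* Viscosity sub- and supersolutions of
     sg * d_t u - sup_k (int delta_z u F_k(dz)) = 0  on I x R,
     u(t0, x) = psi(x),
   where u is considered on J x R with J = I `|` {t0}.  The forward equation
   is sg = 1, t0 = inf I; the backward one is sg = -1, t0 = sup I. *)
Definition viscosity_subsolution (R : realType) (alpha : R) (Km Kp : set R)
    (sg : R) (I J : set R) (t0 : R) (psi : R -> R) (u : R -> R -> R) : Prop :=
  [/\ [bounded unc u p | p in J `*` setT],
      usc_on (J `*` setT) u,
      forall x, u t0 x <= psi x &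
      forall t x phi, I t -> Cb23 I phi ->
        (forall s y, I s -> u s y <= phi s y) -> phi t x = u t x ->
        ((sg * dt 1 phi t x)%:E - levy_sup alpha Km Kp (phi t) x <= 0)%E].

Definition viscosity_supersolution (R : realType) (alpha : R) (Km Kp : set R)
    (sg : R) (I J : set R) (t0 : R) (psi : R -> R) (u : R -> R -> R) : Prop :=
  [/\ [bounded unc u p | p in J `*` setT],
      lsc_on (J `*` setT) u,
      forall x, psi x <= u t0 x &
      forall t x phi, I t -> Cb23 I phi ->
        (forall s y, I s -> phi s y <= u s y) -> phi t x = u t x ->
        (0 <= (sg * dt 1 phi t x)%:E - levy_sup alpha Km Kp (phi t) x)%E].

Definition viscosity_solution (R : realType) (alpha : R) (Km Kp : set R)
    (sg : R) (I J : set R) (t0 : R) (psi : R -> R) (u : R -> R -> R) : Prop :=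
  [/\ bounded_continuous_on (J `*` setT) u,
      viscosity_subsolution alpha Km Kp sg I J t0 psi u &
      viscosity_supersolution alpha Km Kp sg I J t0 psi u].

Definition forward_solution (R : realType) (alpha : R) (Km Kp : set R)
    (psi : R -> R) (u : R -> R -> R) : Prop :=
  viscosity_solution alpha Km Kp 1
    (`]0, +oo[%classic : set R) (`[0, +oo[%classic : set R) 0 psi u.

Definition backward_solution (R : realType) (alpha : R) (Km Kp : set R)
    (h : R) (psi : R -> R) (v : R -> R -> R) : Prop :=
  viscosity_solution alpha Km Kp (-1)
    (`](- h), (1 + h)[%classic : set R) (`](- h), (1 + h)]%classic : set R)
    (1 + h) psi v.

(* Only the X t with 0 <= t are relevant. *)
Record nonlinear_stable_levy (R : realType) (alpha : R) (Km Kp : set R)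
    (S : sublinear_space R) (X : R -> sOmega S -> R) : Prop := {
  nsl_H : forall t, 0 <= t -> sH (X t);
  nsl_0 : forall w, X 0 w = 0;
  nsl_right_cont : forall w t, 0 <= t -> X s w @[s --> t^'+] --> X t w;
  nsl_left_lim : forall w t, 0 < t -> cvg (X s w @[s --> t^'-]);
  nsl_stationary : forall s t, 0 <= s -> s <= t ->
    identically_distributed (fun w => X t w - X s w) (X (t - s));
  nsl_independent : forall (n : nat) (r : 'I_n -> R) (s t : R),
    (forall i, 0 <= r i) -> (forall i j : 'I_n, (i <= j)%N -> r i <= r j) ->
    (forall i, r i <= s) -> 0 <= s -> s <= t ->
    independent_from (fun i => X (r i)) (fun w => X t w - X s w);
  nsl_pde : forall psi : R -> R, CbLip psi ->
    let u t x := sE (fun w => psi (x + X t w)) in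
    forward_solution alpha Km Kp psi u /\
    (forall u', forward_solution alpha Km Kp psi u' ->
       forall t x, 0 <= t -> u' t x = u t x)
}.

Definition iid_seq (R : realType) (S : sublinear_space R)
    (Y : nat -> sOmega S -> R) : Prop :=
  forall i : nat,
    independent_from (fun j : 'I_i.+1 => Y j) (Y i.+1) /\
    identically_distributed (Y i.+1) (Y i).

(* Main.v *)
Require Import Defs.
From mathcomp Require Import all_boot all_order all_algebra.
From mathcomp Require Import all_classical all_reals all_analysis.
From mathcomp Require Import measurable_realfun.
From mathcomp Require Import ring lra.
Import Order.TTheory GRing.Theory Num.Theory.
Import numFieldNormedType.Exports.
Local Open Scope classical_set_scope.
Local Open Scope ring_scope.

(** Let u (t, x) = E [psi (x + X_t)] and v (t, x) = u (1 + h - t, x) for a small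
    h > 0. For h small, v (1, .) is close to psi and v (0, 0) is close to
    E [psi (X_1)], so it suffices that E' [v (1, B_n S_n)] - v (0, 0) tends to 0
    for fixed h. By independence this difference telescopes ([walk_telescope])
    and is at most the sum of n one-step errors, each of which has to be o (1/n)
    uniformly in (t, x):
      E' [v (t, x + B_n Y)] - v (t - 1/n, x).

    Let ell (t, x) be the supremum of the Levy integrals applied to v (t, .) at
    x. Since Y has no mean uncertainty, hypothesis [h_iii] says that
    n (E' [v (t, x + B_n Y)] - v (t, x)) tends to ell (t, x) uniformly
    ([consistency]). What remains is that v solves the equation in the classical
    sense, v (t - 1/n, x) - v (t, x) = ell (t, x) / n + o (1/n), although it is
    only known to be a viscosity solution.

    The regularity that makes this true is contained in [h_iii] itself: ell is a
    uniform limit of functions that inherit the modulus of continuity of v, so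
    it is uniformly continuous ([ell_uniformly_continuous]). Also, ell is
    finite, so the increments of v are integrable for the Levy measures.

    These two facts upgrade the viscosity inequalities. If a smooth function
    touches v from above at (t, x), its space derivative there is the
    one occurring in the increments of v, because a linear function is not
    integrable near 0 for a Levy measure of index greater than 1 ([slope_eq0]). Modifying the
    test function away from x so that it is close to v, the operator applied to
    it becomes close to ell (t, x); hence the time slope of any touching function
    obeys the equation with ell (t, x) on the right-hand side
    ([touching_slope]). By penalization, on a vertical line v then decreases at
    most as fast as the supremum of ell nearby ([time_comparison]), and the same
    argument for - v gives the other inequality. Continuity of ell turns the two
    bounds into a derivative ([time_derivative]).

    The function v enters through hypothesis [h_iii], which concerns backward
    solutions, whereas the process provides a solution of the forward equation;
    [time_reversal] passes from one to the other. *)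

Set Implicit Arguments.
Unset Strict Implicit.
Unset Printing Implicit Defensive.

(** * Bounded Lipschitz functions, sublinear expectations and random walks *)

Section BoundedLipschitz.
Context {R : realType}.

Lemma CbLipP (V : normedModType R) (f : V -> R) : CbLip f <->
  (exists C, forall x, `|f x| <= C) /\
  (exists2 L, 0 <= L & forall x y, `|f x - f y| <= L * `|x - y|).
Proof.
split.
- move=> [bf [M [Mr ML]]]; split.
    have [M' [_ M'f]] := bf; exists (M' + 1) => x.
    by apply: (M'f (M' + 1)) => //; rewrite ltrDl.
  exists (Num.max 0 M + 1); first by rewrite addr_ge0 // le_max lexx.
  have h : M < Num.max 0 M + 1.
    by rewrite (@le_lt_trans _ _ (Num.max 0 M)) ?ltrDl // le_max lexx orbT.
  by move=> x y; exact: (ML _ h (x, y)).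
- move=> [[C fC] [L L0 fL]]; split.
    exists C; split; first exact: num_real.
    by move=> M CM x _; exact: le_trans (fC x) (ltW CM).
  exists L; split; first exact: num_real.
  move=> M LM [x y] _; apply: le_trans (fL x y) _.
  by rewrite ler_wpM2r // ltW.
Qed.

Lemma CbLip_comp (V : normedModType R) (l : V -> R) (g : R -> R) (C : R) :
  0 <= C -> (forall x y, `|l x - l y| <= C * `|x - y|) -> CbLip g ->
  CbLip (fun x => g (l x)).
Proof.
move=> C0 lC /CbLipP [[B gB] [L L0 gL]]; apply/CbLipP; split; first by exists B.
exists (L * C); first by rewrite mulr_ge0.
by move=> x y; rewrite (le_trans (gL _ _)) // -mulrA ler_wpM2l.
Qed.

Lemma coord_le_norm m n (A : 'M[R]_(m, n)) i j : `|A i j| <= `|A|.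
Proof.
rewrite [leRHS]mx_normrE.
exact: (le_bigmax _ (fun ij : 'I_m * 'I_n => `|A ij.1 ij.2|) (i, j)).
Qed.

Lemma CbLip_affine (g : R -> R) (a c : R) : CbLip g -> CbLip (fun x => g (c + a * x)).
Proof.
apply: (@CbLip_comp _ (fun x => c + a * x) g `|a|) => // x y.
by rewrite opprD addrACA subrr add0r -mulrBr normrM.
Qed.

End BoundedLipschitz.

Section SublinearExpectation.
Context {R : realType} {S : sublinear_space R}.
Implicit Types (X Y Z : sOmega S -> R) (g : R -> R).

Lemma sH_comp g Z : sH Z -> CbLip g -> sH (fun w => g (Z w)).
Proof.
move=> HZ Cg.
have := @sH_CbLip R S 1 (fun=> Z) (fun r => g (r ord0 ord0)) (fun=> HZ).
have Cg1 : CbLip (fun r : 'rV[R]_1 => g (r ord0 ord0)).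
  apply: (@CbLip_comp _ _ (fun r : 'rV[R]_1 => r ord0 ord0) g 1) => // x y.
  by rewrite mul1r; have := coord_le_norm (x - y) ord0 ord0; rewrite !mxE.
move=> /(_ Cg1); congr sH; apply/funext => w; by rewrite mxE.
Qed.

Lemma sH_opp Z : sH Z -> sH (fun w => - Z w).
Proof.
by move=> /(sH_scale (-1)); congr sH; apply/funext => w; rewrite mulN1r.
Qed.

Lemma sH_sub X Z : sH X -> sH Z -> sH (fun w => X w - Z w).
Proof. by move=> HX HZ; apply: sH_add => //; exact: sH_opp. Qed.

Lemma sH_sum n (X : nat -> sOmega S -> R) : (forall i, sH (X i)) ->
  sH (fun w => \sum_(i < n) X i w).
Proof.
move=> HX; elim: n => [|n IH].
  have -> : (fun w => \sum_(i < 0) X i w) = (fun=> 0).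
    by apply/funext => w; rewrite big_ord0.
  exact: sH_cst.
have -> : (fun w => \sum_(i < n.+1) X i w) = (fun w => \sum_(i < n) X i w + X n w).
  by apply/funext => w; rewrite big_ord_recr.
exact: sH_add.
Qed.

Lemma sE_le_add X Y c : sH X -> sH Y -> (forall w, X w <= Y w + c) ->
  sE X <= sE Y + c.
Proof.
move=> HX HY XY; apply: (le_trans (sE_mono HX (sH_add HY (sH_cst S c)) XY)).
by rewrite (le_trans (sE_subadd HY (sH_cst S c))) // sE_cst.
Qed.

Lemma sE_dist_cst X Y c : sH X -> sH Y -> (forall w, `|X w - Y w| <= c) ->
  `|sE X - sE Y| <= c.
Proof.
move=> HX HY XY; rewrite ler_distl; apply/andP; split.
  rewrite lerBlDr; apply: sE_le_add => // w.
  by have := XY w; rewrite ler_distl => /andP[+ _]; rewrite lerBlDr.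
apply: sE_le_add => // w.
by have := XY w; rewrite ler_distl => /andP[].
Qed.

Lemma sE_dist X Y Z : sH X -> sH Y -> sH Z -> (forall w, `|X w - Y w| <= Z w) ->
  `|sE X - sE Y| <= sE Z.
Proof.
move=> HX HY HZ XY; rewrite ler_distl; apply/andP; split.
  rewrite lerBlDr; apply: le_trans (sE_subadd HX HZ); apply: sE_mono => //.
    exact: sH_add.
  move=> w; have := XY w; rewrite ler_distl => /andP[+ _]; by rewrite lerBlDr.
apply: le_trans (sE_subadd HY HZ); apply: sE_mono => //; first exact: sH_add.
by move=> w; have := XY w; rewrite ler_distl => /andP[].
Qed.

Lemma sE_bound X c : sH X -> (forall w, `|X w| <= c) -> `|sE X| <= c.
Proof.
move=> HX Xc; have := @sE_dist_cst X (fun=> 0) c HX (sH_cst S 0).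
by rewrite sE_cst subr0; apply => w; rewrite subr0.
Qed.

(** Sublinearity gives E (a Y) <= 0 for both signs of a, so that a summand
    without mean uncertainty neither raises nor lowers the expectation. *)
Lemma sE_add_centered Z Y a : sH Z -> sH Y -> sE Y = 0 -> sE (fun w => - Y w) = 0 ->
  sE (fun w => Z w + a * Y w) = sE Z.
Proof.
move=> HZ HY Y0 NY0.
have E0 b : sE (fun w => b * Y w) <= 0.
  have [b0|b0] := leP 0 b; first by rewrite sE_poshom // Y0 mulr0.
  have -> : (fun w => b * Y w) = (fun w => - b * - Y w).
    by apply/funext => w; rewrite mulrNN.
  by rewrite sE_poshom ?NY0 ?mulr0 // ?oppr_ge0 ?ltW //; exact: sH_opp.
apply/eqP; rewrite eq_le; apply/andP; split.
  rewrite (le_trans (sE_subadd HZ (sH_scale a HY))) //.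
  by have := E0 a; lra.
have -> : sE Z = sE (fun w => (Z w + a * Y w) + - a * Y w).
  by congr sE; apply/funext => w; ring.
rewrite (le_trans (sE_subadd (sH_add HZ (sH_scale a HY)) (sH_scale (- a) HY))) //.
by have := E0 (- a); lra.
Qed.

Lemma sE_add_cst Z c : sH Z -> sE (fun w => Z w + c) = sE Z + c.
Proof.
move=> HZ; apply/eqP; rewrite eq_le; apply/andP; split.
  by apply: sE_le_add => //; apply: sH_add => //; exact: sH_cst.
rewrite -lerBrDr; apply: sE_le_add => //; last by move=> w; rewrite addrK.
by apply: sH_add => //; exact: sH_cst.
Qed.

End SublinearExpectation.

Section RandomWalk.
Context {R : realType} {S : sublinear_space R} (Y : nat -> sOmega S -> R) (B : R).
Hypothesis HY : forall i, sH (Y i).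
Hypothesis iidY : iid_seq Y.

Definition step (g : R -> R) (x : R) : R := sE (fun w => g (x + B * Y 0%N w)).

Lemma sH_step (g : R -> R) x i : CbLip g -> sH (fun w => g (x + B * Y i w)).
Proof.
move=> Cg; apply: (sH_comp (g := fun y => g (x + B * y))) => //.
exact: CbLip_affine.
Qed.

Lemma step_CbLip (g : R -> R) : CbLip g -> CbLip (step g).
Proof.
move=> Cg; have /CbLipP [[C gC] [L L0 gL]] := Cg; apply/CbLipP; split.
  by exists C => x; apply: sE_bound; first exact: sH_step.
exists L => // x y; apply: sE_dist_cst; try exact: sH_step.
by move=> w; rewrite (le_trans (gL _ _)) // opprD addrACA subrr addr0.
Qed.

Lemma ident_Y i (g : R -> R) : CbLip g ->
  sE (fun w => g (Y i w)) = sE (fun w => g (Y 0%N w)).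
Proof.
move=> Cg; elim: i => [//|i <-].
by have [_ ->] := iidY i.
Qed.

(** The last step is independent from the previous ones and can be integrated
    out first. *)
Lemma sE_walkS (g : R -> R) k : CbLip g ->
  sE (fun w => g (B * \sum_(i < k.+1) Y i w)) =
  sE (fun w => step g (B * \sum_(i < k) Y i w)).
Proof.
move=> Cg; case: k => [|k].
  have -> : (fun w => step g (B * \sum_(i < 0) Y i w)) = (fun=> step g 0).
    by apply/funext => w; rewrite big_ord0 mulr0.
  rewrite sE_cst /step; congr sE; apply/funext => w.
  by rewrite big_ord_recl big_ord0 addr0 add0r.
have [ind _] := iidY k.
pose psi (r : 'rV[R]_(k.+1 + 1)) : R := g (B * \sum_j r ord0 j).
have Cpsi : CbLip psi.
  apply: (@CbLip_comp _ _ (fun r : 'rV[R]_(k.+1 + 1) => B * \sum_j r ord0 j) g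
    (`|B| * (k.+1 + 1)%:R)) => //.
  move=> x y; rewrite -mulrBr normrM -mulrA ler_wpM2l //.
  rewrite -sumrB (le_trans (ler_norm_sum _ _ _)) //.
  rewrite (le_trans (ler_sum (G := fun=> `|x - y|) _ _)) //; last first.
    by rewrite sumr_const card_ord mulr_natl.
  by move=> j _; have := coord_le_norm (x - y) ord0 j; rewrite !mxE.
have psiE w w' : psi (row_mx (\row_(i < k.+1) Y i w) (const_mx (Y k.+1 w'))) =
    g (B * \sum_(i < k.+1) Y i w + B * Y k.+1 w').
  rewrite /psi big_split_ord /= big_ord1 row_mxEr mxE mulrDr.
  by under eq_bigr do rewrite row_mxEl mxE.
have := ind _ Cpsi.
have -> : (fun w => psi (row_mx (\row_(i < k.+1) Y i w) (const_mx (Y k.+1 w)))) =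
    (fun w => g (B * \sum_(i < k.+2) Y i w)).
  by apply/funext => w; rewrite psiE [in RHS]big_ord_recr /= mulrDr.
move=> ->; congr sE; apply/funext => w.
have -> : (fun w' => psi (row_mx (\row_(i < k.+1) Y i w) (const_mx (Y k.+1 w')))) =
    (fun w' => g (B * \sum_(i < k.+1) Y i w + B * Y k.+1 w')).
  by apply/funext => w'; rewrite psiE.
exact: (ident_Y _ (CbLip_affine B _ Cg)).
Qed.

(** Integrating out the last step turns V (n + 1) into an approximation of V n
    along the walk, with the one-step error; by monotonicity the expectation
    does not amplify it. *)
Lemma walk_telescope (V : nat -> R -> R) (eta : R) n :
  (forall k, CbLip (V k)) ->
  (forall k x, (k < n)%N -> `|step (V k.+1) x - V k x| <= eta) ->
  `|sE (fun w => V n (B * \sum_(i < n) Y i w)) - V 0%N 0| <= n%:R * eta.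
Proof.
move=> CV; elim: n => [|n IH] Vstep.
  have -> : (fun w => V 0%N (B * \sum_(i < 0) Y i w)) = (fun=> V 0%N 0).
    by apply/funext => w; rewrite big_ord0 mulr0.
  by rewrite sE_cst subrr normr0 mul0r.
have HS m : sH (fun w => B * \sum_(i < m) Y i w) by apply: sH_scale; exact: sH_sum.
have {}IH := IH (fun k x kn => Vstep k x (ltnW kn)).
rewrite sE_walkS // -natr1 mulrDl mul1r [leRHS]addrC.
rewrite (le_trans (ler_distD (sE (fun w => V n (B * \sum_(i < n) Y i w))) _ _)) //.
apply: lerD => //; apply: sE_dist_cst.
- by apply: sH_comp => //; exact: step_CbLip.
- exact: sH_comp.
- by move=> w; exact: Vstep.
Qed.

End RandomWalk.

(** * Functions with bounded derivatives *)

Section Derivatives.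
Context {R : realType}.
Implicit Types (f g : R -> R) (x y c : R).

Lemma isd_cst c x : is_derive x 1 (fun=> c) (0 : R).
Proof. exact: is_derive_cst. Qed.

Lemma isd_add f g x df dg : is_derive x 1 f df -> is_derive x 1 g dg ->
  is_derive x 1 (fun y => f y + g y) (df + dg).
Proof. by move=> fx gx; exact: is_deriveD. Qed.

Lemma isd_mul f g x df dg : is_derive x 1 f df -> is_derive x 1 g dg ->
  is_derive x 1 (fun y => f y * g y) (df * g x + f x * dg).
Proof.
move=> fx gx; have h := is_deriveM fx gx.
apply: (@is_derive_eq _ _ _ _ _ _ _ _ h).
by rewrite addrC; congr (_ + _); rewrite /GRing.scale /= mulrC.
Qed.

Lemma isd_comp f g x df dg : is_derive (g x) 1 f df -> is_derive x 1 g dg ->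
  is_derive x 1 (fun y => f (g y)) (df * dg).
Proof. exact: is_derive1_comp. Qed.

Lemma isd_affine a c x : is_derive x 1 (fun y => a * y + c) a.
Proof.
have h := isd_add (isd_mul (isd_cst a x) (is_derive_id x 1)) (isd_cst c x).
by apply: (@is_derive_eq _ _ _ _ _ _ _ _ h); rewrite mul0r add0r mulr1 addr0.
Qed.

Lemma isd_continuous f df x : is_derive x 1 f df -> {for x, continuous f}.
Proof.
move=> fx; apply: differentiable_continuous.
by apply/derivable1_diffP; exact: ex_derive.
Qed.

Lemma isd_derive1 f df x : is_derive x 1 f df -> derive1 f x = df.
Proof. by move=> h; rewrite derive1E; exact: derive_val. Qed.

Lemma isd_derivable f df x : is_derive x 1 f df -> derivable f x 1.
Proof. by case. Qed.

Lemma derivable_isd f x : derivable f x 1 -> is_derive x 1 f (derive1 f x).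
Proof. by move=> h; apply: DeriveDef => //; rewrite derive1E. Qed.

Lemma MVT_isd f (df : R -> R) x y : (forall z : R, is_derive z 1 f (df z)) -> x <= y ->
  exists2 c, x <= c <= y & f y - f x = df c * (y - x).
Proof.
move=> fd xy; have [|c] := @MVT_segment R f df x y xy (fun z _ => fd z).
  by apply: continuous_subspaceT => z; exact: isd_continuous (fd z).
by rewrite in_itv /=; exists c.
Qed.

End Derivatives.

Section Antiderivative.
Context {R : realType}.
Notation mu := (@lebesgue_measure R).

(** Near x, the integral anchored at 0 differs by a constant from the integral
    with any fixed base point far enough to the left, to which the fundamental
    theorem of calculus applies. *)
Lemma exists_antiderivative (f : R -> R) : continuous f ->
  exists F : R -> R, forall x : R, is_derive x 1 F (f x).
Proof.
move=> cf.
have fi (a b : R) : mu.-integrable `[a, b] (EFin \o f).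
  apply: continuous_compact_integrable; first exact: segment_compact.
  exact: continuous_subspaceT.
pose G a x := (\int[mu]_(t in `[a, x]) f t)%R.
pose F x := if 0 <= x then (\int[mu]_(t in `]0%R, x]) f t)%R
            else - (\int[mu]_(t in `]x, 0%R]) f t)%R.
have FG a x : a < 0 -> a < x -> F x = G a x - G a 0.
  move=> a0 ax; rewrite /F; case: ifPn => x0.
    by rewrite /G Rintegral_itvB // bnd_simp // ltW.
  move: x0; rewrite -ltNge => x0.
  by rewrite -opprB /G Rintegral_itvB // bnd_simp // ltW.
exists F => x.
pose a : R := - (`|x| + 1).
have a0 : a < 0 by rewrite oppr_lt0 ltr_wpDl.
have ax : a < x by rewrite /a; have := ler_norm (- x); rewrite normrN; lra.
have [dG G'] := @continuous_FTC1_closed R f a x (x + 1) (ltr_pwDr ltr01 (lexx x))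
  (fi _ _) ax (cf x).
have GE : is_derive x 1 (G a) (f x).
  by apply: DeriveDef; [exact: dG|rewrite -derive1E; exact: G'].
have h := isd_add GE (isd_cst (- G a 0) x); rewrite addr0 in h.
apply: near_eq_is_derive h; near=> y.
by rewrite (FG a) //; near: y; exact: lt_nbhsr.
Unshelve. all: by end_near. Qed.

End Antiderivative.

Section SmoothBounded.
Context {R : realType}.
Implicit Types (f g : R -> R) (n : nat).

(** C_b^n (R), as a chain of derivatives, so that closure properties follow by
    induction on n. *)
Fixpoint Cb n f : Prop :=
  [/\ continuous f, (exists C, forall x, `|f x| <= C) &
    match n with
    | 0 => True
    | m.+1 => exists2 g, (forall x : R, is_derive x 1 f (g x)) & Cb m g
    end].

Lemma Cb_bounded n f : Cb n f -> exists C, forall x, `|f x| <= C.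
Proof. by case: n => [|n] []. Qed.

Lemma Cb_continuous n f : Cb n f -> continuous f.
Proof. by case: n => [|n] []. Qed.

Lemma CbS n f : Cb n.+1 f -> Cb n f.
Proof.
elim: n f => [|n IH] f [cf bf [g fg Cg]]; first by split.
by split => //; exists g => //; exact: IH.
Qed.

Lemma Cb_derive n f : Cb n.+1 f ->
  (forall x : R, is_derive x 1 f (derive1 f x)) /\ Cb n (derive1 f).
Proof.
move=> [_ _ [g fg Cg]]; have -> : derive1 f = g by apply/funext => x; exact: isd_derive1.
by [].
Qed.

Lemma Cb_cst n (c : R) : Cb n (fun=> c).
Proof.
elim: n c => [|n IH] c; (split; first exact: cst_continuous).
- by exists `|c|.
- by [].
- by exists `|c|.
- by exists (fun=> 0) => // x; exact: isd_cst.
Qed.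

Lemma Cb_add n f g : Cb n f -> Cb n g -> Cb n (fun x => f x + g x).
Proof.
elim: n f g => [|n IH] f g [cf [C fC] Hf] [cg [C' gC] Hg]; split.
- by move=> x; apply: continuousD; [exact: cf|exact: cg].
- by exists (C + C') => x; rewrite (le_trans (ler_normD _ _)) // lerD.
- by [].
- by move=> x; apply: continuousD; [exact: cf|exact: cg].
- by exists (C + C') => x; rewrite (le_trans (ler_normD _ _)) // lerD.
- move: Hf Hg => [f' ff' Cf'] [g' gg' Cg'].
  by exists (fun x => f' x + g' x); [move=> x; exact: isd_add|exact: IH].
Qed.

Lemma Cb_mul n f g : Cb n f -> Cb n g -> Cb n (fun x => f x * g x).
Proof.
elim: n f g => [|n IH] f g Cf Cg;
  have [cf [C fC] Hf] := Cf; have [cg [C' gC] Hg] := Cg; split.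
- by move=> x; apply: continuousM; [exact: cf|exact: cg].
- by exists (C * C') => x; rewrite normrM ler_pM.
- by [].
- by move=> x; apply: continuousM; [exact: cf|exact: cg].
- by exists (C * C') => x; rewrite normrM ler_pM.
- move: Hf Hg => [f' ff' Cf'] [g' gg' Cg'].
  exists (fun x => f' x * g x + f x * g' x); first by move=> x; exact: isd_mul.
  by apply: Cb_add; apply: IH => //; exact: CbS.
Qed.

Lemma Cb_affine n f (a c : R) : Cb n f -> Cb n (fun x => f (a * x + c)).
Proof.
elim: n f => [|n IH] f [cf [C fC] Hf]; split.
- move=> x; apply: (@continuous_comp _ _ _ (fun x => a * x + c) f); last exact: cf.
  exact: isd_continuous (isd_affine a c x).
- by exists C.
- by [].
- move=> x; apply: (@continuous_comp _ _ _ (fun x => a * x + c) f); last exact: cf.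
  exact: isd_continuous (isd_affine a c x).
- by exists C.
- move: Hf => [f' ff' Cf'].
  exists (fun x => f' (a * x + c) * a).
    by move=> x; apply: isd_comp; exact: isd_affine.
  by apply: Cb_mul; [exact: IH|exact: Cb_cst].
Qed.

(** zeta is a weight concentrated at 0. The derivatives of zeta and theta are
    polynomials in zeta and theta, whence bounds at every order. *)
Definition zeta (x : R) : R := (1 + x ^+ 2)^-1.
Definition theta (x : R) : R := x / (1 + x ^+ 2).

Lemma den_gt0 (x : R) : 0 < 1 + x ^+ 2.
Proof. by rewrite ltr_pwDl // sqr_ge0. Qed.

Lemma isd_zeta (x : R) : is_derive x 1 zeta (- 2 * theta x * zeta x).
Proof.
have h0 := isd_add (isd_cst 1 x) (isd_mul (is_derive_id x 1) (is_derive_id x 1)).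
have n0 : 1 + x * x != 0 by rewrite -expr2 gt_eqF // den_gt0.
have h := @is_deriveV R (fun y => 1 + y * y) x _ 1 n0 h0.
have -> : zeta = fun y => (1 + y * y)^-1 by apply/funext => y; rewrite /zeta expr2.
apply: (@is_derive_eq _ _ _ _ _ _ _ _ h).
by rewrite /GRing.scale /= /theta /zeta expr2; field.
Qed.

Lemma isd_theta (x : R) : is_derive x 1 theta (zeta x - 2 * theta x * theta x).
Proof.
have h := isd_mul (is_derive_id x 1) (isd_zeta x).
apply: (@is_derive_eq _ _ _ _ _ _ _ _ h).
have n0 : 1 + x * x != 0 by rewrite -expr2 gt_eqF // den_gt0.
by rewrite /theta /zeta expr2; field.
Qed.

Lemma zeta_bound (x : R) : 0 < zeta x <= 1.
Proof.
by rewrite /zeta invr_gt0 den_gt0 invf_le1 ?den_gt0 // lerDl sqr_ge0.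
Qed.

Lemma theta_bound (x : R) : `|theta x| <= 1.
Proof.
rewrite /theta normrM normfV (gtr0_norm (den_gt0 x)) ler_pdivrMr ?den_gt0 // mul1r.
have := sqr_ge0 (`|x| - 1); have := real_normK (num_real x).
rewrite -(real_normK (num_real x)); have := normr_ge0 x; nra.
Qed.

Lemma Cb_zeta_theta n : Cb n zeta /\ Cb n theta.
Proof.
have cz : continuous zeta by move=> x; exact: isd_continuous (isd_zeta x).
have ct : continuous theta by move=> x; exact: isd_continuous (isd_theta x).
have bz : exists C, forall x, `|zeta x| <= C.
  by exists 1 => x; have /andP[z0 z1] := zeta_bound x; rewrite gtr0_norm.
have bt : exists C, forall x, `|theta x| <= C by exists 1; exact: theta_bound.
elim: n => [//|n [IHz IHt]]; split; split => //.
- exists (fun x => - 2 * theta x * zeta x); first exact: isd_zeta.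
  by apply: Cb_mul => //; apply: Cb_mul => //; exact: Cb_cst.
- exists (fun x => zeta x + - 1 * (2 * theta x * theta x)).
    by move=> x; rewrite mulN1r; exact: isd_theta.
  apply: Cb_add => //; apply: Cb_mul; first exact: Cb_cst.
  by apply: Cb_mul => //; apply: Cb_mul => //; exact: Cb_cst.
Qed.

(** The difference quotient over [x, x + d] of an antiderivative of f is an
    average of f. Its derivative is the difference quotient of f itself, which
    is as regular as f. *)
Lemma window_average n f (L d : R) : 0 < d -> Cb n f ->
  (forall x y, `|f x - f y| <= L * `|x - y|) ->
  exists g, [/\ Cb n.+1 g, forall x y, `|g x - g y| <= L * `|x - y| &
                forall x, `|g x - f x| <= L * d].
Proof.
move=> d0 Cf fL.
have [F Ff] := exists_antiderivative (Cb_continuous Cf).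
have L0 : 0 <= L by have := fL 1 0; rewrite subr0 normr1 mulr1; exact: le_trans.
pose g x := (F (x + d) - F x) / d.
have gMVT x : exists2 c, x <= c <= x + d & g x = f c.
  have [|c cI cE] := @MVT_isd R F f x (x + d) Ff; first by rewrite lerDl ltW.
  by exists c => //; rewrite /g cE addrAC subrr add0r mulfK // gt_eqF.
have g' (x : R) : is_derive x 1 g ((f (x + d) - f x) / d).
  have h1 := @isd_comp R F (fun y => 1 * y + d) x _ _ (Ff (1 * x + d)) (isd_affine 1 d x).
  have h2 := isd_mul (isd_cst (-1) x) (Ff x).
  have h3 := isd_mul (isd_add h1 h2) (isd_cst d^-1 x).
  have -> : g = fun y => (F (1 * y + d) + -1 * F y) / d.
    by apply/funext => y; rewrite /g mul1r mulN1r.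
  apply: (@is_derive_eq _ _ _ _ _ _ _ _ h3).
  by rewrite mul1r; ring.
have gL x y : `|g x - g y| <= L * `|x - y|.
  have h (s : R) : is_derive s 1 (fun r => F (1 * r + x) + -1 * F (1 * r + y))
      (f (s + x) - f (s + y)).
    have h1 := @isd_comp R F (fun y => 1 * y + x) s _ _ (Ff (1 * s + x)) (isd_affine 1 x s).
    have h2 := isd_mul (isd_cst (-1) s)
      (@isd_comp R F (fun r => 1 * r + y) s _ _ (Ff (1 * s + y)) (isd_affine 1 y s)).
    have h3 := isd_add h1 h2.
    by apply: (@is_derive_eq _ _ _ _ _ _ _ _ h3); rewrite !mul1r; ring.
  have [c _ cE] := MVT_isd h (ltW d0).
  have -> : g x - g y = f (c + x) - f (c + y).
    apply: (mulIf (lt0r_neq0 d0)); rewrite -[d in RHS]subr0 -cE.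
    rewrite /g mulrBl !divfK ?gt_eqF // !mul1r !add0r (addrC d) (addrC d).
    by ring.
  apply: (le_trans (fL _ _)); rewrite (_ : c + x - (c + y) = x - y) //; ring.
exists g; split => //.
- split.
  + by move=> x; exact: isd_continuous (g' x).
  + have [C fC] := Cb_bounded Cf; exists C => x.
    by have [c _ ->] := gMVT x.
  + exists (fun x => (f (1 * x + d) + -1 * f x) / d).
      by move=> x; rewrite mul1r mulN1r.
    apply: Cb_mul; last exact: Cb_cst.
    apply: Cb_add; first exact: Cb_affine.
    by apply: Cb_mul => //; exact: Cb_cst.
- move=> x; have [c /andP[c1 c2] ->] := gMVT x.
  apply: (le_trans (fL _ _)); rewrite ler_wpM2l // ger0_norm; lra.
Qed.

(** Three successive window averages gain three derivatives. *)
Lemma smooth_approx f (L e : R) : 0 < e ->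
  (exists C, forall x, `|f x| <= C) ->
  (forall x y, `|f x - f y| <= L * `|x - y|) ->
  exists2 g, Cb 3 g & forall x, `|g x - f x| <= e.
Proof.
move=> e0 bf fL.
have L0 : 0 <= L by have := fL 1 0; rewrite subr0 normr1 mulr1; exact: le_trans.
have C0 : Cb 0 f.
  split => // x; apply/cvgrPdist_le => r r0.
  near=> y; rewrite (le_trans (fL _ _)) //.
  have : `|x - y| <= r / (L + 1).
    by near: y; apply: cvgr_dist_le; [exact: cvg_id|rewrite divr_gt0 // ltr_wpDl].
  rewrite ler_pdivlMr ?ltr_wpDl //; have := normr_ge0 (x - y); nra.
pose d := e / (3 * (L + 1)).
have d0 : 0 < d by rewrite divr_gt0 // mulr_gt0 // ltr_wpDl.
have [g1 [C1 g1L g1f]] := window_average d0 C0 fL.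
have [g2 [C2 g2L g2f]] := window_average d0 C1 g1L.
have [g3 [C3 g3L g3f]] := window_average d0 C2 g2L.
exists g3 => // x.
have -> : g3 x - f x = (g3 x - g2 x) + (g2 x - g1 x) + (g1 x - f x) by ring.
rewrite (le_trans (ler_normD _ _)) // (le_trans (lerD (ler_normD _ _) (lexx _))) //.
apply: (@le_trans _ _ (L * d + L * d + L * d)); first by rewrite !lerD.
have -> : L * d + L * d + L * d = e * (L / (L + 1)) by rewrite /d; field; lra.
by rewrite ler_piMr ?(ltW e0) // ler_pdivrMr ?ltr_wpDl // mul1r lerDl.
Unshelve. all: by end_near. Qed.

End SmoothBounded.

(** * The stable Levy measure *)

Section PowerIntegrals.
Context {R : realType}.
Implicit Types (x z p : R).
Notation mu := (@lebesgue_measure R).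

(** The profile common to all the Levy densities of index al. It vanishes at
    z = 0, by the value of the power function there. *)
Definition nu (al z : R) : R := `|z| `^ (- al - 1).

(** The growth, quadratic at 0 and linear at infinity, of the increments delta
    of a function of class C_b^2. *)
Definition tame (z : R) : R := Num.min (z ^+ 2) `|z|.

Lemma nu_ge0 al z : 0 <= nu al z. Proof. exact: powR_ge0. Qed.

Lemma tame_ge0 z : 0 <= tame z.
Proof. by rewrite /tame le_min sqr_ge0 normr_ge0. Qed.

Lemma measurable_nu al : measurable_fun [set: R] (nu al).
Proof.
by apply: (@measurableT_comp _ _ _ _ R _ (@powR R ^~ (- al - 1))).
Qed.

Lemma measurable_tame : measurable_fun [set: R] tame.
Proof.
apply: measurable_minr; first exact: exprn_measurable.
exact: normr_measurable.
Qed.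

Lemma is_derive_powR p x : 0 < x -> is_derive x 1 (fun y : R => y `^ p) (p * x `^ (p - 1)).
Proof.
move=> x0; have xI : x \in `]0, +oo[%R by rewrite in_itv/= x0.
apply: DeriveDef; first exact: (@derivable_powR R 1 p _ xI).
by rewrite -derive1E (@powR_derive1 R p _ xI).
Qed.

Lemma is_derive_powR_prim p x : p != 0 -> 0 < x ->
  is_derive x 1 (fun y : R => y `^ p / p) (x `^ (p - 1)).
Proof.
move=> p0 x0; have -> : (fun y : R => y `^ p / p) = (p^-1 \*o (fun y : R => y `^ p)).
  by apply/funext => y /=; rewrite mulrC.
have h := is_derive_powR p x0.
apply: is_derive_eq.
by rewrite [_ *: _]mulrA mulVf // mul1r.
Qed.

Lemma integral_powR_near0 (p a : R) : 0 < p -> 0 < a -> a < 1 ->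
  (\int[mu]_(z in `[a, 1%R]) (z `^ (p - 1)%R)%:E <= (p^-1)%:E)%E.
Proof.
move=> p0 a0 a1.
have pn0 : p != 0 by rewrite gt_eqF.
rewrite (@continuous_FTC2 _ _ (fun y => y `^ p / p)) //.
- by rewrite -EFinB lee_fin powR1 mul1r gerBl divr_ge0 ?powR_ge0 // ltW.
- apply: derivable_within_continuous => x; rewrite in_itv/= => /andP[ax _].
  by have [] := is_derive_powR (p - 1) (lt_le_trans a0 ax).
- split.
  + move=> x; rewrite in_itv/= => /andP[ax _].
    by have [] := is_derive_powR_prim pn0 (lt_trans a0 ax).
  + apply: cvg_at_right_filter; 
    exact: (isd_continuous (is_derive_powR_prim pn0 a0)).
  + apply: cvg_at_left_filter; 
    exact: (isd_continuous (is_derive_powR_prim pn0 ltr01)).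
- move=> x; rewrite in_itv/= => /andP[ax _].
  have h := is_derive_powR_prim pn0 (lt_trans a0 ax).
  by rewrite derive1E; exact: derive_val.
Qed.

Lemma integral_powR01 p : 0 < p ->
  (\int[mu]_(z in `]0%R, 1%R]) (z `^ (p - 1)%R)%:E <= (p^-1)%:E)%E.
Proof.
move=> p0.
have mf (A : set R) : measurable_fun A (fun z : R => (z `^ (p - 1))%:E).
  by apply: measurable_funTS; apply/measurable_EFinP; exact: measurable_powR.
rewrite (@itv_open_bnd_bigcup R false 1 0).
have nd : nondecreasing_seq (fun n : nat => `[0 + n.+1%:R^-1, 1]%classic : set R).
  move=> m n mn; rewrite subsetEset; apply: subset_itvr; rewrite bnd_simp !add0r.
  by rewrite lef_pV2 ?posrE // ler_nat ltnS.
have /= H := @ge0_nondecreasing_set_cvg_integral _ (measurableTypeR R) R _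
  (fun z => (z `^ (p - 1))%:E) mu nd (fun=> measurable_itv _) (fun=> mf _)
  (fun _ z _ => powR_ge0 z (p - 1)).
rewrite -(cvg_lim _ H) //; apply: lime_le; first by apply/cvg_ex; eexists; exact: H.
near=> n.
apply: integral_powR_near0 => //.
rewrite add0r invf_lt1 ?ltr0n // ltr1n ltnS.
by near: n; exact: nbhs_infty_gt.
Unshelve. all: by end_near. Qed.

Lemma integral_powR1y p : p < 0 ->
  (\int[mu]_(z in `[1%R, +oo[) (z `^ (p - 1)%R)%:E = (- p^-1)%:E)%E.
Proof.
move=> p0.
have pn0 : p != 0 by rewrite lt_eqF.
rewrite (@ge0_continuous_FTC2y _ _ (fun y => y `^ p / p) 1 0) //.
- by rewrite powR1 div1r sub0e.
- by move=> x _; exact: powR_ge0.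
- apply: derivable_within_continuous => x; rewrite in_itv/= andbT => ax.
  by have [] := is_derive_powR (p - 1) (lt_le_trans ltr01 ax).
- rewrite -(mul0r p^-1); apply: cvgMl.
  have lny : ln x @[x --> +oo%R] --> (+oo%R : set_system R).
    apply/cvgryPge => A; near=> x.
    have x0 : 0 < x by near: x; exact: nbhs_pinfty_gt.
    have xA : expR A <= x by near: x; exact: nbhs_pinfty_ge.
    by rewrite -[leLHS]expRK ler_ln ?posrE ?expR_gt0.
  have H : (fun x : R => expR (- (- p * ln x))) @ +oo%R --> (0 : R).
    apply: (@cvg_comp _ _ _ (fun x : R => - p * ln x) (fun y => expR (- y)) _ (+oo%R)).
      by apply: gt0_cvgMry => //; rewrite oppr_gt0.
    exact: cvgr_expR.
  apply: cvg_trans H; apply: near_eq_cvg; near=> x.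
  have x0 : 0 < x by near: x; exact: nbhs_pinfty_gt.
  by rewrite /powR gt_eqF // mulNr opprK.
- move=> x x1.
  by have [] := is_derive_powR_prim pn0 (lt_trans ltr01 x1).
- apply: cvg_at_right_filter; 
    exact: (isd_continuous (is_derive_powR_prim pn0 ltr01)).
- move=> x; rewrite in_itv/= andbT => x1.
  have h := is_derive_powR_prim pn0 (lt_trans ltr01 x1).
  by rewrite derive1E; exact: derive_val.
Unshelve. all: by end_near. Qed.

End PowerIntegrals.

Section StableDensity.
Context {R : realType}.
Implicit Types (x z p : R).
Notation mu := (@lebesgue_measure R).

Lemma le_integral_EFin (D : set R) (f g : R -> R) : measurable D ->
  measurable_fun D f -> measurable_fun D g ->
  (forall z, D z -> 0 <= f z) -> (forall z, D z -> f z <= g z) ->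
  (\int[mu]_(z in D) (f z)%:E <= \int[mu]_(z in D) (g z)%:E)%E.
Proof.
move=> mD mf mg f0 fg; apply: ge0_le_integral => //; try exact/measurable_EFinP.
Qed.

Lemma integral_even (f : R -> R) : measurable_fun [set: R] f ->
  (forall z, 0 <= f z) -> (forall z, f (- z) = f z) ->
  (\int[mu]_(z in [set: R]) (f z)%:E =
   \int[mu]_(z in `[0%R, +oo[) (f z)%:E + \int[mu]_(z in `[0%R, +oo[) (f z)%:E)%E.
Proof.
move=> mf f0 fe.
have mfE (A : set R) : measurable_fun A (fun z => (f z)%:E).
  by apply: measurable_funTS; apply/measurable_EFinP.
have -> : [set: R] = `]-oo, 0] `|` `]0, +oo[.
  apply/seteqP; split => // z _ /=; rewrite !in_itv/= andbT.
  by case: (leP z 0) => _; [left|right].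
rewrite ge0_integral_setU //=.
- rewrite integral_itv_obnd_cbnd // ge0_integration_by_substitution0 //.
  by congr (_ + _)%E; apply: eq_integral => z _; rewrite fe.
- exact: mfE.
- by move=> z _; rewrite lee_fin.
- apply/disj_setPS => z /= []; rewrite !in_itv/= andbT => z0.
  by rewrite ltNge z0.
Qed.

Lemma nu_pos al z : 0 < z -> nu al z = z `^ (- al - 1).
Proof. by move=> z0; rewrite /nu gtr0_norm. Qed.

Lemma nuN al z : nu al (- z) = nu al z.
Proof. by rewrite /nu normrN. Qed.

Lemma measurable_tame_nu al :
  measurable_fun [set: R] (fun z => tame z * nu al z).
Proof. apply: measurable_funM; [exact: measurable_tame|exact: measurable_nu]. Qed.

(** The Levy measure integrates z^2 near the origin since al < 2 and |z| at
    infinity since 1 < al. *)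
Lemma tame_nu_integrable al : 1 < al -> al < 2 ->
  mu.-integrable [set: R] (fun z => (tame z * nu al z)%:E).
Proof.
move=> al1 al2; apply/integrableP; split.
  by apply/measurable_EFinP; exact: measurable_tame_nu.
have f0 z : 0 <= tame z * nu al z by rewrite mulr_ge0 ?tame_ge0 ?nu_ge0.
under eq_integral do rewrite gee0_abs ?lee_fin //.
have mf := measurable_tame_nu al.
have mfE (A : set R) : measurable_fun A (fun z => (tame z * nu al z)%:E).
  by apply: measurable_funTS; apply/measurable_EFinP.
have mpE (A : set R) p : measurable_fun A (fun z => (z `^ p)%:E).
  by apply: measurable_funTS; apply/measurable_EFinP; exact: measurable_powR.
rewrite (integral_even mf) //; last first.
  by move=> z; rewrite nuN /tame normrN sqrrN.
suff H : (\int[mu]_(z in `[0%R, +oo[) (tame z * nu al z)%:E < +oo)%E.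
  exact: lte_add_pinfty.
have -> : `[0, +oo[%classic = `[0, 1] `|` `]1, +oo[ :> set R.
  apply/seteqP; split => z /=; rewrite !in_itv/= !andbT.
    by move=> ->; case: (leP z 1) => _; [left|right].
  by case=> [/andP[]//|]; move=> /(lt_trans ltr01)/ltW.
rewrite ge0_integral_setU //=; last 2 first.
- by move=> z _; rewrite lee_fin.
- apply/disj_setPS => z /= []; rewrite !in_itv/= andbT => /andP[_ z0].
  by rewrite ltNge z0.
rewrite -integral_itv_obnd_cbnd // (@integral_itv_obnd_cbnd _ 1) //.
apply: lte_add_pinfty.
- have al0 : 0 < 2 - al by rewrite subr_gt0.
  apply: (le_lt_trans _ (le_lt_trans (integral_powR01 al0) (ltry _))).
  apply: le_integral_EFin => //; try exact: measurable_funTS.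
  move=> z; rewrite /= in_itv/= => /andP[z0 z1].
  apply: (@le_trans _ _ (z ^+ 2 * z `^ (- al - 1))).
    by rewrite nu_pos // ler_wpM2r ?powR_ge0 // /tame ge_min lexx.
  rewrite -powR_mulrn ?(ltW z0) // -powRD; last by rewrite (gt_eqF z0) implybT.
  by have -> : 2 + (- al - 1) = 2 - al - 1 by ring.
- have al0 : 1 - al < 0 by rewrite subr_lt0.
  apply: (@le_lt_trans _ _ (- (1 - al)^-1)%:E); last exact: ltry.
  rewrite -(integral_powR1y al0).
  apply: le_integral_EFin => //; try exact: measurable_funTS.
  move=> z; rewrite /= in_itv/= andbT => z1.
  have z0 : 0 < z by exact: lt_le_trans ltr01 z1.
  apply: (@le_trans _ _ (z * z `^ (- al - 1))).
    by rewrite nu_pos // ler_wpM2r ?powR_ge0 // /tame ge_min (gtr0_norm z0) lexx orbT.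
  rewrite -[X in X * _](powRr1 (ltW z0)) -powRD; last by rewrite (gt_eqF z0) implybT.
  by have -> : 1 + (- al - 1) = 1 - al - 1 by ring.
- exact: mfE.
Qed.

Lemma integral_inv (a r : R) : 0 < a -> a < r ->
  (\int[mu]_(z in `[a, r]) (z^-1)%:E = (ln r - ln a)%:E)%E.
Proof.
move=> a0 ar; have r0 := lt_trans a0 ar.
rewrite (@continuous_FTC2 _ _ (@ln R)) //.
- apply: derivable_within_continuous => x; rewrite in_itv/= => /andP[ax _].
  by apply: derivableV; [rewrite gt_eqF // (lt_le_trans a0)|exact: derivable_id].
- split.
  + move=> x; rewrite in_itv/= => /andP[ax _].
    by have [] := is_derive1_ln (lt_trans a0 ax).
  + by apply: cvg_at_right_filter; exact: (isd_continuous (is_derive1_ln a0)).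
  + by apply: cvg_at_left_filter; exact: (isd_continuous (is_derive1_ln r0)).
- move=> x; rewrite in_itv/= => /andP[ax _].
  have h := is_derive1_ln (lt_trans a0 ax).
  by rewrite derive1E; exact: derive_val.
Qed.

(** The integral of c / z over [r exp (- A / c), r] is A, for every A > 0. *)
Lemma inv_not_integrable (g : R -> R) c r : 0 < c -> 0 < r ->
  measurable_fun [set: R] g -> (forall z, 0 <= g z) ->
  (forall z, 0 < z -> z <= r -> c / z <= g z) ->
  (\int[mu]_(z in `[0%R, +oo[) (g z)%:E = +oo)%E.
Proof.
move=> c0 r0 mg g0 cg; apply/eqyP => A A0.
have mgE (B : set R) : measurable_fun B (fun z => (g z)%:E).
  by apply: measurable_funTS; apply/measurable_EFinP.
pose a := r * expR (- (A / c)).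
have a0 : 0 < a by rewrite mulr_gt0 ?expR_gt0.
have ar : a < r by rewrite gtr_pMr // expR_lt1 oppr_lt0 divr_gt0.
apply: (@le_trans _ _ (\int[mu]_(z in `[a, r]) (g z)%:E)%E); last first.
  apply: ge0_subset_integral => //=; first exact: mgE.
    by move=> z _; rewrite lee_fin.
  by move=> z /=; rewrite !in_itv/= => /andP[az _]; rewrite ?andbT (le_trans (ltW a0)).

have mi : measurable_fun `[a, r] (fun z : R => (c * z^-1)%:E).
  apply/measurable_EFinP; apply: measurable_funM => //.
  apply: subspace_continuous_measurable_fun => //.
  apply: derivable_within_continuous => x; rewrite in_itv/= => /andP[ax _].
  by apply: derivableV; [rewrite gt_eqF // (lt_le_trans a0)|exact: derivable_id].
apply: (@le_trans _ _ (\int[mu]_(z in `[a, r]) (c * z^-1)%:E)%E); last first.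
  apply: le_integral_EFin => //.
  - exact/measurable_EFinP.
  - exact: measurable_funTS.
  - move=> z; rewrite /= in_itv/= => /andP[az zr].
    by rewrite mulr_ge0 ?invr_ge0 ?(ltW c0) // (le_trans (ltW a0)).
  - move=> z; rewrite /= in_itv/= => /andP[az zr].
    by apply: cg => //; exact: lt_le_trans az.
under eq_integral do rewrite EFinM.
rewrite ge0_integralZl_EFin //=; last 3 first.
- move=> z; rewrite in_itv/= => /andP[az zr].
  by rewrite lee_fin invr_ge0 (le_trans (ltW a0)).
- apply/measurable_EFinP.
  apply: subspace_continuous_measurable_fun => //.
  apply: derivable_within_continuous => x; rewrite in_itv/= => /andP[ax _].
  by apply: derivableV; [rewrite gt_eqF // (lt_le_trans a0)|exact: derivable_id].
- exact: ltW.
rewrite integral_inv // -EFinM lee_fin /a lnM ?posrE ?expR_gt0 // expRK.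
by rewrite opprD opprK addNKr mulrC divfK // gt_eqF.
Qed.

End StableDensity.

(** * Perturbation of the Levy operator *)

Section LevyOperator.
Context {R : realType}.
Implicit Types (x z p : R).
Notation mu := (@lebesgue_measure R).

Lemma levy_densityE (al km kp z : R) : - al - 1 != 0 ->
  levy_density al km kp z = (if z < 0 then km else kp) * nu al z.
Proof.
move=> al0; rewrite /levy_density /nu !indicE !mem_setE !in_itv/= andbT.
have [z0|z0|->] := ltgtP z 0; rewrite ?mulr1 ?mulr0 ?addr0 ?add0r //.
by rewrite normr0 powR0 // !mulr0.
Qed.

Lemma levy_density_le (al lam Lam km kp z : R) : - al - 1 != 0 ->
  lam < km < Lam -> lam < kp < Lam ->
  lam * nu al z <= levy_density al km kp z <= Lam * nu al z.
Proof.
move=> al0 /andP[km1 km2] /andP[kp1 kp2]; rewrite levy_densityE //.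
by case: ifP => _; rewrite !ler_wpM2r ?nu_ge0 // ltW.
Qed.

Lemma measurable_levy_density (al km kp : R) :
  measurable_fun [set: R] (levy_density al km kp).
Proof.
apply: measurable_funM; last exact: measurable_nu.
by apply: measurable_funD; apply: measurable_funM => //; exact: measurable_indic.
Qed.

Lemma measurable_delta (f : R -> R) x : continuous f ->
  measurable_fun [set: R] (delta f x).
Proof.
move=> cf; apply: measurable_funB.
  apply: measurable_funB => //.
  apply: continuous_measurable_fun => z.
  by apply: continuous_comp; [apply: cvgD; [exact: cvg_cst|exact: cvg_id]|exact: cf].
by apply: measurable_funM.
Qed.

Lemma integrable_of_fin_num (h : R -> R) : measurable_fun [set: R] h ->
  (\int[mu]_(z in [set: R]) (h z)%:E)%E \is a fin_num ->
  mu.-integrable [set: R] (fun z => (h z)%:E).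
Proof.
move=> mh; have mhE : measurable_fun [set: R] (EFin \o h) by exact/measurable_EFinP.
rewrite integralE fin_numB => /andP[hp hn].
apply/integrableP; split => //.
have -> : (fun z : R => `|(h z)%:E|)%E = ((EFin \o h)^\+ \+ (EFin \o h)^\-)%E.
  by rewrite -fune_abse.
rewrite ge0_integralD //; last 2 first.
  exact: measurable_funepos.
  exact: measurable_funeneg.
by rewrite lte_add_pinfty // -ge0_fin_numE // ?integral_ge0.
Qed.

Context (al lam Lam : R) (Km Kp : set R).
Hypothesis al0 : 1 < al.
Hypothesis lam0 : 0 < lam.
Hypothesis KmI : Km `<=` `]lam, Lam[.
Hypothesis KpI : Kp `<=` `]lam, Lam[.

Let aln0 : - al - 1 != 0. Proof. by apply/eqP; have := al0; lra. Qed.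

Lemma density_bounds km kp z : Km km -> Kp kp ->
  lam * nu al z <= levy_density al km kp z <= Lam * nu al z.
Proof.
move=> /KmI /=; rewrite in_itv/= => km1 /KpI /=; rewrite in_itv/= => kp1.
exact: levy_density_le.
Qed.

Lemma density_ge0 km kp z : Km km -> Kp kp -> 0 <= levy_density al km kp z.
Proof.
move=> /density_bounds/[apply] => /(_ z)/andP[+ _]; apply: le_trans.
by rewrite mulr_ge0 ?nu_ge0 // ltW.
Qed.

Lemma density_integrable (h : R -> R) km kp : Km km -> Kp kp ->
  measurable_fun [set: R] h ->
  mu.-integrable [set: R] (fun z => (h z * nu al z)%:E) ->
  mu.-integrable [set: R] (fun z => (h z * levy_density al km kp z)%:E).
Proof.
move=> Kmk Kpk mh ih.
have Lih : mu.-integrable [set: R] (fun z => (Lam%:E * (h z * nu al z)%:E)%E).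
  exact: integrableZl.
apply: le_integrable Lih => //.
  apply/measurable_EFinP; apply: measurable_funM => //.
  exact: measurable_levy_density.
move=> z _; rewrite -EFinM !abse_EFin lee_fin.
have /andP[_ dL] := density_bounds z Kmk Kpk.
rewrite [X in _ <= `|X|]mulrCA normrM [leRHS]normrM ler_wpM2l //.
by rewrite !ger0_norm ?density_ge0 // (le_trans _ dL) ?density_ge0.
Qed.

(** The finite value of the supremum forces integrability against nu: all the
    densities are comparable to nu, and a finite supremum is attained up to an
    error by finite integrals. *)
Lemma levy_sup_integrable (f : R -> R) x : continuous f ->
  levy_sup al Km Kp f x \is a fin_num ->
  mu.-integrable [set: R] (fun z => (delta f x z * nu al z)%:E).
Proof.
move=> cf fin.
have [k [Kmk Kpk] fk] : exists2 k, (Km `*` Kp) k &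
    levy_integral al k.1 k.2 f x \is a fin_num.
  apply: contrapT => nk.
  have nfin k : (Km `*` Kp) k -> levy_integral al k.1 k.2 f x = -oo%E.
    move=> Kk; have : ~~ (levy_integral al k.1 k.2 f x \is a fin_num).
      by apply/negP => fk; apply: nk; exists k.
    have : (levy_integral al k.1 k.2 f x <= levy_sup al Km Kp f x)%E.
      by apply: ereal_sup_ubound; exists k.
    move: fin; rewrite !fin_numE.
    by case: levy_sup => //= s _; case: levy_integral.
  suff E : levy_sup al Km Kp f x = -oo%E by move: fin; rewrite E.
  by apply/eqP; rewrite -leeNy_eq; apply: ge_ereal_sup => _ [k Kk <-]; rewrite nfin.
have mf := measurable_delta x cf.
have {fk} : mu.-integrable [set: R] (fun z => (delta f x z * levy_density al k.1 k.2 z)%:E).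
  apply: integrable_of_fin_num => //; apply: measurable_funM => //.
  exact: measurable_levy_density.
move=> /(integrableZl measurableT lam^-1); apply: le_integrable => //.
  by apply/measurable_EFinP; apply: measurable_funM => //; exact: measurable_nu.
move=> z _; rewrite -EFinM !abse_EFin lee_fin.
have /andP[dL _] := density_bounds z Kmk Kpk.
rewrite [X in _ <= `|X|]mulrCA normrM [leRHS]normrM ler_wpM2l // !ger0_norm ?nu_ge0 //.
  by rewrite mulrC ler_pdivlMr // mulrC.
by rewrite mulr_ge0 ?density_ge0 // invr_ge0 ltW.
Qed.

Lemma levy_integral_perturb (f g : R -> R) (x e : R) (D : R -> R) km kp :
  Km km -> Kp kp -> continuous f -> continuous g ->
  measurable_fun [set: R] D ->
  (forall z, `|delta f x z - delta g x z| <= D z) ->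
  mu.-integrable [set: R] (fun z => (delta g x z * nu al z)%:E) ->
  mu.-integrable [set: R] (fun z => (D z * nu al z)%:E) ->
  (\int[mu]_(z in [set: R]) (D z * nu al z)%:E <= e%:E)%E ->
  (levy_integral al km kp f x <= levy_integral al km kp g x + (Lam * e)%:E /\
   levy_integral al km kp g x <= levy_integral al km kp f x + (Lam * e)%:E)%E.
Proof.
move=> Kmk Kpk cf cg mD fgD ig iD De.
have D0 z : 0 <= D z by exact: le_trans (fgD z).
have mf := measurable_delta x cf; have mg := measurable_delta x cg.
pose dens := levy_density al km kp.
have mdens : measurable_fun [set: R] dens by exact: measurable_levy_density.
have d0 z : 0 <= dens z by exact: density_ge0.
have igk := density_integrable Kmk Kpk mg ig.
have iDk := density_integrable Kmk Kpk mD iD.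
have ifk : mu.-integrable [set: R] (fun z => (delta f x z * dens z)%:E).
  have iB : mu.-integrable [set: R] (fun z => (`|delta g x z * dens z| + D z * dens z)%:E).
    have := integrableD measurableT (integrable_abse igk) iDk.
    by apply: eq_integrable => // z _; rewrite /= EFinD.
  apply: le_integrable iB => //.
    by apply/measurable_EFinP; apply: measurable_funM.
  move=> z _; rewrite !abse_EFin lee_fin [leRHS]ger0_norm; last first.
    by rewrite addr_ge0 // mulr_ge0 // d0.
  have fgDz := fgD z.
  rewrite (normrM _ (dens z)) (normrM (delta g x z) (dens z)) (ger0_norm (d0 z)) -mulrDl.
  rewrite ler_wpM2r ?d0 //.
  have -> : delta f x z = delta g x z + (delta f x z - delta g x z) by ring.
  by rewrite (le_trans (ler_normD _ _)) // lerD2l.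
have De' : (\int[mu]_(z in [set: R]) (D z * dens z)%:E <= (Lam * e)%:E)%E.
  have LD : (\int[mu]_(z in [set: R]) (D z * dens z)%:E <=
      \int[mu]_(z in [set: R]) (Lam * (D z * nu al z))%:E)%E.
    apply: le_integral_EFin => //.
    - by apply: measurable_funM.
    - by apply: measurable_funM => //; apply: measurable_funM => //; exact: measurable_nu.
    - by move=> z _; rewrite mulr_ge0 // d0.
    - move=> z _; rewrite [leRHS]mulrCA ler_wpM2l //.
      by have /andP[] := density_bounds z Kmk Kpk.
  apply: (le_trans LD).
  under eq_integral do rewrite EFinM.
  rewrite integralZl // EFinM lee_wpmul2l // lee_fin.
  have /KmI /= := Kmk; rewrite in_itv/= => /andP[a1 a2].
  by rewrite ltW // (lt_trans lam0) // (lt_trans a1).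
have dist (F G : R -> R) :
    mu.-integrable [set: R] (fun z => (F z * dens z)%:E) ->
    mu.-integrable [set: R] (fun z => (G z * dens z)%:E) ->
    (forall z, F z <= G z + D z) ->
    (\int[mu]_(z in [set: R]) (F z * dens z)%:E <=
     \int[mu]_(z in [set: R]) (G z * dens z)%:E + (Lam * e)%:E)%E.
  move=> iF iG FG.
  apply: (@le_trans _ _
    (\int[mu]_(z in [set: R]) ((G z * dens z)%:E + (D z * dens z)%:E))%E).
    apply: le_integral => //; first exact: integrableD.
    by move=> z _; rewrite -EFinD lee_fin -mulrDl ler_wpM2r ?d0.
  by rewrite integralD // leeD2l.
split; apply: dist => // z; have := fgD z; rewrite ler_distl => /andP[h1 h2]; lra.
Qed.

(** Every density of the family is at most Lam nu, so one bound on the increments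
    serves all the measures at once. *)
Lemma levy_sup_perturb (f g : R -> R) (x e r : R) (D : R -> R) :
  continuous f -> continuous g ->
  measurable_fun [set: R] D ->
  (forall z, `|delta f x z - delta g x z| <= D z) ->
  mu.-integrable [set: R] (fun z => (D z * nu al z)%:E) ->
  (\int[mu]_(z in [set: R]) (D z * nu al z)%:E <= e%:E)%E ->
  levy_sup al Km Kp g x = r%:E ->
  (levy_sup al Km Kp f x <= (r + Lam * e)%:E /\
   (r - Lam * e)%:E <= levy_sup al Km Kp f x)%E.
Proof.
move=> cf cg mD fgD iD De gr.
have ig : mu.-integrable [set: R] (fun z => (delta g x z * nu al z)%:E).
  by apply: levy_sup_integrable => //; rewrite gr.
have H km kp (Kmk : Km km) (Kpk : Kp kp) :=
  levy_integral_perturb Kmk Kpk cf cg mD fgD ig iD De.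
split.
  apply: ge_ereal_sup => _ [k [Kmk Kpk] <-].
  have [h1 _] := H _ _ Kmk Kpk; apply: (le_trans h1).
  by rewrite EFinD leeD2r // -gr; apply: ereal_sup_ubound; exists k.
rewrite EFinB leeBlDr // -gr.
apply: ge_ereal_sup => _ [k [Kmk Kpk] <-].
have [_ h2] := H _ _ Kmk Kpk; apply: (le_trans h2).
by rewrite leeD2r //; apply: ereal_sup_ubound; exists k.
Qed.

End LevyOperator.

Section ConcentrationAndSlopes.
Context {R : realType}.
Implicit Types (x z p : R).
Notation mu := (@lebesgue_measure R).

(** Dominated convergence: the weight 1 / (1 + (j z)^2) tends to 0 off the
    origin, where nu vanishes. The term tame / j stands for the error of a
    smooth approximation made away from the origin. *)
Lemma concentrating_integral_small (al e : R) (E : R -> R) :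
  1 < al -> al < 2 -> measurable_fun [set: R] E -> (forall z, 0 <= E z) ->
  mu.-integrable [set: R] (fun z => (E z * nu al z)%:E) -> 0 < e ->
  exists j : nat, [/\ (0 < j)%N,
    mu.-integrable [set: R]
      (fun z => (((1 + (j%:R * z) ^+ 2)^-1 * E z + j%:R^-1 * tame z) * nu al z)%:E) &
    (\int[mu]_(z in [set: R])
      (((1 + (j%:R * z) ^+ 2)^-1 * E z + j%:R^-1 * tame z) * nu al z)%:E <= e%:E)%E].
Proof.
move=> al1 al2 mE E0 iE e0.
pose f (n : nat) z : R :=
  ((1 + (n.+1%:R * z) ^+ 2)^-1 * E z + n.+1%:R^-1 * tame z) * nu al z.
have den_ge1 n z : 1 <= 1 + (n.+1%:R * z) ^+ 2 by rewrite lerDl sqr_ge0.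
have chi0 n z : 0 <= (1 + (n.+1%:R * z) ^+ 2)^-1.
  by rewrite invr_ge0 (le_trans ler01).
have chi1 n z : (1 + (n.+1%:R * z) ^+ 2)^-1 <= 1.
  by rewrite invf_le1 // (lt_le_trans ltr01).
have n0 n : 0 <= n.+1%:R^-1 :> R by [].
have n1 n : n.+1%:R^-1 <= 1 :> R by rewrite invf_le1 // ler1n.
have f0 n z : 0 <= f n z.
  by rewrite mulr_ge0 ?nu_ge0 // addr_ge0 // mulr_ge0 ?tame_ge0.
have mchi n : measurable_fun [set: R] (fun z : R => (1 + (n.+1%:R * z) ^+ 2)^-1).
  apply: continuous_measurable_fun => z; apply: cvgV.
    by rewrite gt_eqF // (lt_le_trans ltr01).
  apply: cvgD; first exact: cvg_cst.
  by apply: cvgM; apply: cvgMr; exact: cvg_id.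
have mf n : measurable_fun [set: R] (f n).
  apply: measurable_funM; last exact: measurable_nu.
  apply: measurable_funD; apply: measurable_funM => //.
  exact: measurable_tame.
have mfE n : measurable_fun [set: R] (fun z => (f n z)%:E) by exact/measurable_EFinP.
have ig : mu.-integrable [set: R] (fun z => (E z * nu al z + tame z * nu al z)%:E).
  have := integrableD measurableT iE (tame_nu_integrable al1 al2).
  by apply: eq_integrable => // z _; rewrite /= EFinD.
have fg n z : f n z <= E z * nu al z + tame z * nu al z.
  rewrite /f mulrDl lerD // ler_wpM2r ?nu_ge0 // ler_piMl //.
  exact: tame_ge0.
have fc z : (f n z)%:E @[n --> \oo] --> (0 : \bar R)%E.
  suff fc : f n z @[n --> \oo] --> (0 : R) by apply: cvg_EFin => //; exact: nearW.
  have [->|z0] := eqVneq z 0.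
    have -> : (fun n => f n 0) = (fun=> 0).
      by apply/funext => n; rewrite /f /nu normr0 powR0 ?mulr0 //; apply/eqP; lra.
    exact: cvg_cst.
  pose C := (E z / z ^+ 2 + tame z) * nu al z.
  have zz0 : 0 < z ^+ 2 by rewrite exprn_even_gt0.
  apply: (@squeeze_cvgr _ _ _ _ (fun=> 0) (fun n => n.+1%:R^-1 * C)).
  - apply: nearW => n; rewrite f0 /= /f /C mulrA ler_wpM2r ?nu_ge0 // mulrDr lerD2r.
    have h : (1 + (n.+1%:R * z) ^+ 2)^-1 <= n.+1%:R^-1 * (z ^+ 2)^-1.
      rewrite -invfM lef_pV2 ?posrE; last 2 first.
      + by rewrite (lt_le_trans ltr01).
      + by rewrite mulr_gt0.
      apply: (@le_trans _ _ ((n.+1%:R * z) ^+ 2)); last by rewrite lerDr.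
      by rewrite exprMn ler_pM2r // expr2 ler_peMl // ler1n.
    by rewrite mulrCA [leLHS]mulrC ler_wpM2l.
  - exact: cvg_cst.
  - rewrite -(mul0r C); apply: cvgMl; exact: cvg_harmonic.
have H : (\int[mu]_(z in [set: R]) (f n z)%:E)%E @[n --> \oo] --> (0 : \bar R)%E.
  have := @dominated_cvg _ _ R mu [set: R] measurableT (fun n z => (f n z)%:E)
    (fun=> 0%E) (fun z => (E z * nu al z + tame z * nu al z)%:E).
  rewrite integral0; apply => // n z _.
  by rewrite abse_EFin lee_fin ger0_norm.
have : \forall n \near \oo, (\int[mu]_(z in [set: R]) (f n z)%:E < e%:E)%E.
  by apply: (H [set y | (y < e%:E)%E]); apply: open_ereal_lt'; rewrite lte_fin.
move=> [N _ /(_ N (leqnn N)) HN].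
exists N.+1; split => //; last exact: ltW.
apply: (@le_integrable _ _ R mu [set: R] measurableT _ _ (mfE N) _ ig) => z _.
rewrite !abse_EFin lee_fin (ger0_norm (f0 N z)) ger0_norm; first exact: fg.
by rewrite addr_ge0 // mulr_ge0 ?nu_ge0 ?tame_ge0.
Qed.

(** A nonzero linear part is not integrable against the Levy measure because
    1 < al; an integrable nonnegative function cannot dominate it near 0. *)
Lemma slope_eq0 (al q K : R) (h : R -> R) : 1 < al -> al < 2 ->
  measurable_fun [set: R] h ->
  mu.-integrable [set: R] (fun z => (h z * nu al z)%:E) ->
  (forall z, `|z| <= 1 -> q * z <= `|h z| + K * z ^+ 2) -> q = 0.
Proof.
move=> al1 al2 mh ih hq; apply/eqP/negP => /negP q0.
have q'0 : 0 < `|q| by rewrite normr_gt0.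
(* only the half line on which q z is positive matters *)
pose s : R := Num.sg q.
pose g z : R := `|(`|h z| + `|K| * tame z) * nu al z|.
have gE z : g z = (`|h z| + `|K| * tame z) * nu al z.
  by rewrite /g ger0_norm // mulr_ge0 ?nu_ge0 // addr_ge0 // mulr_ge0 ?tame_ge0.
have mg : measurable_fun [set: R] g.
  apply: measurableT_comp => //; apply: measurable_funM; last exact: measurable_nu.
  apply: measurable_funD; first exact: measurableT_comp.
  by apply: measurable_funM => //; exact: measurable_tame.
have ig : mu.-integrable [set: R] (fun z => (g z)%:E).
  have i2 := integrableZl measurableT `|K| (tame_nu_integrable al1 al2).
  have := integrableD measurableT (integrable_abse ih) i2.
  apply: eq_integrable => // z _; rewrite /= -EFinM -EFinD gE.
  by rewrite normrM (ger0_norm (nu_ge0 _ _)) mulrDl mulrA.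
pose gs z : R := g (s * z).
have ss : s * s = 1.
  by rewrite /s -expr2 sqr_sg q0.
have gs_int : (\int[mu]_(z in `[0%R, +oo[) (gs z)%:E <=
    \int[mu]_(z in [set: R]) (g z)%:E)%E.
  have g0 z : (0 <= (g z)%:E)%E by rewrite lee_fin normr_ge0.
  have mgE (B : set R) : measurable_fun B (fun z => (g z)%:E).
    by apply: measurable_funTS; apply/measurable_EFinP.
  have [s1|s1] : s = 1 \/ s = -1.
    have : (s - 1) * (s + 1) = 0 by rewrite -subr_sqr_1 expr2 ss subrr.
    move/eqP; rewrite mulf_eq0 subr_eq0 addr_eq0 => /orP[/eqP ->|/eqP ->]; by [left|right].
  - have -> : gs = g by apply/funext => z; rewrite /gs s1 mul1r.
    apply: ge0_subset_integral => //=; exact: mgE.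
  - have -> : gs = g \o -%R by apply/funext => z; rewrite /gs s1 mulN1r.
    have mgN : measurable_fun [set: R] (g \o -%R) by apply: measurableT_comp.
    have mgNE : measurable_fun [set: R] (fun z => (g (- z))%:E) by exact/measurable_EFinP.
    rewrite (ge0_integration_by_substitution0 mgNE (fun z => g0 (- z))).
    under eq_integral do rewrite opprK.
    apply: ge0_subset_integral => //=; exact: mgE.
have mgs : measurable_fun [set: R] gs.
  by apply: measurableT_comp => //; apply: measurable_funM.
have q2 : 0 < `|q| by [].
have := @inv_not_integrable R gs `|q| 1 q2 ltr01 mgs (fun z => normr_ge0 _).
have lb z : 0 < z -> z <= 1 -> `|q| / z <= gs z.
  move=> z0 z1; rewrite /gs gE.
  have nsz : nu al (s * z) = nu al z.
    by rewrite /nu normrM /s normr_sg q0 mul1r.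
  rewrite nsz.
  have sz : `|s * z| = z by rewrite normrM /s normr_sg q0 mul1r gtr0_norm.
  have := hq (s * z); rewrite sz => /(_ z1).
  rewrite mulrA (mulrC q) /s -normrEsg.
  have E2 : (Num.sg q * z) ^+ 2 = z ^+ 2 by rewrite exprMn sqr_sg q0 mul1r.
  rewrite E2 => h1.
  have tz : tame (Num.sg q * z) = z ^+ 2.
    rewrite /tame E2 -/s sz; apply/min_idPl.
    by rewrite expr2 ler_piMl // ltW.
  have h2 : `|q| * z <= `|h (Num.sg q * z)| + `|K| * tame (Num.sg q * z).
    rewrite tz (le_trans h1) // lerD2l ler_wpM2r ?sqr_ge0 //; exact: ler_norm.
  apply: (@le_trans _ _ (`|q| * z * nu al z)); last by rewrite ler_wpM2r ?nu_ge0.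
  rewrite -mulrA ler_wpM2l // nu_pos //.
  rewrite -[X in _ <= X * _](powRr1 (ltW z0)) -powRD; last by rewrite (gt_eqF z0) implybT.
  rewrite -powR_inv1 ?(ltW z0) //; apply: ger_powR; last lra.
  by rewrite z0 z1.
move=> /(_ lb) gsoo; move: gs_int; rewrite gsoo leye_eq => /eqP goo.
by have := integrable_fin_num measurableT ig; rewrite goo.
Qed.

End ConcentrationAndSlopes.

(** * Bounded continuous functions of time and space *)

Section BoundedContinuous.
Context {R : realType}.
Implicit Types (D : set (R * R)) (u v : R -> R -> R).

Lemma bounded_onP D (f : R * R -> R) :
  [bounded f p | p in D] <-> exists C, forall p, D p -> `|f p| <= C.
Proof.
split.
  move=> [M [_ Mf]]; exists (M + 1) => p Dp.
  by apply: (Mf (M + 1)) => //; rewrite ltrDl.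
move=> [C fC]; exists C; split; first exact: num_real.
by move=> M CM p Dp; exact: le_trans (fC p Dp) (ltW CM).
Qed.

Lemma within_contP D u : {within D, continuous (unc u)} <->
  (forall t x, D (t, x) -> forall e, 0 < e -> exists2 d, 0 < d &
     forall s y, D (s, y) -> `|s - t| < d -> `|y - x| < d -> `|u s y - u t x| < e).
Proof.
split.
- move=> /subspace_continuousP cu t x Dtx e e0.
  have /cvgrPdist_lt/(_ e e0) := cu _ Dtx.
  move=> /nbhs_ballP [d /= d0 H]; exists d => // s y Dsy st yx.
  rewrite distrC; apply: (H (s, y)) => //.
  by split; rewrite /ball /= distrC.
- move=> H; apply/subspace_continuousP => -[t x] Dtx.
  apply/cvgrPdist_lt => e e0; have [d d0 Hd] := H t x Dtx e e0.
  apply/nbhs_ballP; exists d => //= -[s y] [/= st yx] Dsy.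
  by rewrite distrC; apply: Hd => //; rewrite distrC.
Qed.

Lemma continuous_usc D u : {within D, continuous (unc u)} -> usc_on D u.
Proof.
move=> /subspace_continuousP cu p a Dp ua.
by have := cu p Dp; move=> /(cvgr_lt _); apply.
Qed.

Lemma continuous_lsc D u : {within D, continuous (unc u)} -> lsc_on D u.
Proof.
move=> /subspace_continuousP cu p a Dp ua.
by have := cu p Dp; move=> /(cvgr_gt _); apply.
Qed.

Lemma bco_add D u v : bounded_continuous_on D u -> bounded_continuous_on D v ->
  bounded_continuous_on D (fun t x => u t x + v t x).
Proof.
move=> [/subspace_continuousP cu /bounded_onP [C uC]].
move=> [/subspace_continuousP cv /bounded_onP [C' vC]]; split.
  by apply/subspace_continuousP => p Dp; apply: cvgD; [exact: cu|exact: cv].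
apply/bounded_onP; exists (C + C') => p Dp.
by rewrite (le_trans (ler_normD _ _)) // lerD ?uC ?vC.
Qed.

Lemma bco_mul D u v : bounded_continuous_on D u -> bounded_continuous_on D v ->
  bounded_continuous_on D (fun t x => u t x * v t x).
Proof.
move=> [/subspace_continuousP cu /bounded_onP [C uC]].
move=> [/subspace_continuousP cv /bounded_onP [C' vC]]; split.
  by apply/subspace_continuousP => p Dp; apply: cvgM; [exact: cu|exact: cv].
apply/bounded_onP; exists (C * C') => p Dp.
by rewrite /unc normrM ler_pM // ?uC ?vC.
Qed.

Lemma bco_cst D c : bounded_continuous_on D (fun=> fun=> c).
Proof.
split; first by apply/subspace_continuousP => p Dp; exact: cvg_cst.
by apply/bounded_onP; exists `|c|.
Qed.

Lemma bco_time D (f : R -> R) : (forall t, {for t, continuous f}) ->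
  (exists C, forall t x, D (t, x) -> `|f t| <= C) ->
  bounded_continuous_on D (fun t x => f t).
Proof.
move=> cf [C fC]; split; last by apply/bounded_onP; exists C => -[t x]; exact: fC.
apply/subspace_continuousP => -[t x] _.
apply: (@cvg_within_filter _ _ (fun p : R * R => f p.1)).
exact: (@continuous_comp _ _ _ fst f (t, x) cvg_fst (cf t)).
Qed.

Lemma bco_space D (f : R -> R) : (forall t, {for t, continuous f}) ->
  (exists C, forall t, `|f t| <= C) ->
  bounded_continuous_on D (fun t x => f x).
Proof.
move=> cf [C fC]; split; last by apply/bounded_onP; exists C => -[t x] _; exact: fC.
apply/subspace_continuousP => -[t x] _.
apply: (@cvg_within_filter _ _ (fun p : R * R => f p.2)).
exact: (@continuous_comp _ _ _ snd f (t, x) cvg_snd (cf x)).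
Qed.

End BoundedContinuous.

(** * Cut-off in time *)

Section CutOff.
Context {R : realType}.

Lemma isd_flat (f : R -> R) (x C : R) :
  (forall y, `|y - x| <= 1 -> `|f y - f x| <= C * `|y - x| ^+ 2) -> is_derive x 1 f 0.
Proof.
move=> fC.
have C0 : 0 <= C.
  have := fC (x + 1); rewrite addrAC subrr add0r normr1 expr1n mulr1 => /(_ (lexx _)).
  exact: le_trans.
suff H : h^-1 *: (f (h *: 1 + x) - f x) @[h --> 0^'] --> (0 : R).
  by apply: DeriveDef; [apply/cvg_ex; exists 0|apply/cvg_lim].
apply/cvgrPdist_le => e e0; near=> h.
have h0 : h != 0 by near: h; exact: nbhs_dnbhs_neq.
have he : `|h| <= e / (C + 1).
  near: h; apply: dnbhs0_le; rewrite divr_gt0 // ltr_wpDl //.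
have h1 : `|h| <= 1 by near: h; apply: dnbhs0_le.
rewrite sub0r normrN normrM normfV ler_pdivrMl ?normr_gt0 //.
have := fC (h *: 1 + x); rewrite addrK /GRing.scale /= mulr1 => /(_ h1)/le_trans; apply.
rewrite expr2 mulrCA ler_wpM2l //.
apply: (@le_trans _ _ (C * (e / (C + 1)))); first by rewrite ler_wpM2l.
have -> : C * (e / (C + 1)) = e * (C / (C + 1)) by ring.
by rewrite ler_piMr ?(ltW e0) // ler_pdivrMr ?ltr_wpDl // mul1r lerDl.
Unshelve. all: by end_near. Qed.

Definition pospow (n : nat) (y : R) : R := Num.max 0 y ^+ n.

Lemma isd_pospow n (y : R) : (1 < n)%N ->
  is_derive y 1 (pospow n) (n%:R * pospow n.-1 y).
Proof.
case: n => [//|[//|n]] _; have [y0|y0|->] := ltgtP y 0.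
- rewrite /pospow max_l ?(ltW y0) // expr0n mulr0.
  apply: near_eq_is_derive (isd_cst 0 y); near=> z.
  rewrite max_l ?expr0n // ltW //; near: z; exact: lt_nbhsl.
- rewrite /pospow max_r ?(ltW y0) //=.
  have h := @is_deriveX R R id n.+2 y 1 1 (is_derive_id y 1).
  have {}h : is_derive y 1 (fun z => z ^+ n.+2) (n.+2%:R * y ^+ n.+1).
    have -> : (fun z : R => z ^+ n.+2) = id ^+ n.+2 by apply/funext => z; rewrite fctE.
    by apply: (@is_derive_eq _ _ _ _ _ _ _ _ h); rewrite /GRing.scale /= mulr1.
  apply: near_eq_is_derive h; near=> z.
  by rewrite max_r // ltW //; near: z; exact: lt_nbhsr.
- have -> : n.+2%:R * pospow n.+1 0 = 0 by rewrite /pospow max_l // expr0n mulr0.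
  apply: (@isd_flat _ _ 1) => z; rewrite subr0 mul1r => z1.
  have -> : pospow n.+2 0 = 0 by rewrite /pospow max_l // expr0n.
  rewrite subr0 /pospow.
  have z0 : 0 <= Num.max 0 z by rewrite le_max lexx.
  rewrite ger0_norm ?exprn_ge0 //.
  have zz : Num.max 0 z <= `|z| by rewrite ge_max normr_ge0 ler_norm.
  apply: (@le_trans _ _ (Num.max 0 z ^+ 2)); last by rewrite lerXn2r // nnegrE.
  rewrite -addn2 exprD ler_piMl ?exprn_ge0 // exprn_ile1 //.
  exact: le_trans zz z1.
Unshelve. all: by end_near. Qed.

End CutOff.

Section Lift.
Context {R : realType} (a b tau0 r : R).
Hypothesis r0 : 0 < r.
Hypothesis rl : 0 < tau0 - r.
Hypothesis ru : tau0 + r < b - a.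
Notation I := (`]a, b[%classic : set R).
Notation I' := (`]0, +oo[%classic : set R).

Definition supported (K : R -> R) := forall tau, r <= `|tau - tau0| -> K tau = 0.

Lemma supported_bounded K : continuous K -> supported K ->
  exists C, forall tau, `|K tau| <= C.
Proof.
move=> cK sK.
have le : tau0 - r <= tau0 + r by have := r0; lra.
have cN : {within `[tau0 - r, tau0 + r], continuous (fun x => `|K x|)}.
  apply: continuous_subspaceT => x.
  by apply: (continuous_comp (cK x)); exact: norm_continuous.
have [c _ Kc] := EVT_max le cN; exists `|K c| => tau.
have [H|H] := leP r `|tau - tau0|; first by rewrite sK // normr0.
apply: Kc; rewrite in_itv/=; move: H; rewrite ltr_norml => /andP[h1 h2].
by apply/andP; split; lra.
Qed.

Lemma supported_in tau : ~ I (b - tau) -> r < `|tau - tau0|.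
Proof.
move=> nI; rewrite ltNge; apply/negP; rewrite ler_norml => /andP[h1 h2]; apply: nI.
by rewrite /= in_itv/=; have := rl; have := ru; move=> *; apply/andP; split; lra.
Qed.

Lemma supported_near0 K tau : supported K -> ~ I (b - tau) ->
  \forall s \near tau, K s = 0.
Proof.
move=> sK /supported_in rt; near=> s; apply: sK.
have : `|s - tau| <= `|tau - tau0| - r.
  by near: s; apply: cvgr_distC_le; [exact: cvg_id|rewrite subr_gt0].
by have := ler_distD s tau tau0; rewrite (distrC tau s); lra.
Unshelve. all: by end_near. Qed.

(** The weight K vanishes near every tau for which b - tau leaves ]a, b[, so the
    product extends continuously by 0. *)
Lemma lift_bco K (f : R -> R -> R) : continuous K -> supported K ->
  bounded_continuous_on (I `*` setT) f ->
  bounded_continuous_on (I' `*` setT) (fun tau x => K tau * f (b - tau) x).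
Proof.
move=> cK sK [cf /bounded_onP [C fC]].
have [M KM] := supported_bounded cK sK; split; last first.
  apply/bounded_onP; exists (M * `|C|) => -[tau x] _; rewrite /unc /=.
  have [Ib|nI] := pselect (I (b - tau)).
    rewrite normrM ler_pM // (le_trans _ (ler_norm _)) //.
    exact: (fC (b - tau, x)).
  have /sK -> := ltW (supported_in nI).
  by rewrite mul0r normr0 mulr_ge0 // (le_trans _ (KM 0)).
apply/subspace_continuousP => -[tau x] _.
suff H : (fun p : R * R => K p.1 * f (b - p.1) p.2) @ nbhs (tau, x) -->
    K tau * f (b - tau) x by exact: (@cvg_within_filter _ _ (fun p : R * R => _) _ _ _ _ H).
have cK1 : (fun p : R * R => K p.1) @ nbhs (tau, x) --> K tau.
  exact: (@continuous_comp _ _ _ fst K (tau, x) cvg_fst (cK tau)).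
have [Ib|nI] := pselect (I (b - tau)).
  apply: cvgM; first exact: cK1.
  have nI : \forall p \near (b - tau, x), I p.1.
    by apply: (@cvg_fst R R (nbhs (b - tau)) (nbhs x)); exact: near_in_itvoo.
  have cfx : {for (b - tau, x), continuous (unc f)}.
    move=> U Uf; move: cf => /subspace_continuousP /(_ (b - tau, x) (conj Ib Logic.I) U Uf).
    by move: nI; apply: filterS2 => -[t y] /= It; apply.
  apply: (@continuous_comp _ _ _ (fun p : R * R => (b - p.1, p.2)) (unc f) (tau, x) _ cfx).
  have h1 : (fun p : R * R => b - p.1) @ nbhs (tau, x) --> b - tau.
    by apply: cvgB; [exact: cvg_cst|exact: cvg_fst].
  exact: (cvg_pair h1 cvg_snd).
have K0 : K tau = 0 by apply: sK; exact: ltW (supported_in nI).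
rewrite K0 mul0r.
apply: (@cvg_trans _ ((fun=> 0 : R) @ nbhs (tau, x))); last exact: cvg_cst.
apply: near_eq_cvg; have := supported_near0 sK nI => H.
have : nbhs (tau, x) [set p : R * R | K p.1 = 0].
  exists ([set s | K s = 0], setT); first by split => //=; exact: filterT.
  by move=> -[s y] [/= Ks _].
by apply: filterS => p ->; rewrite mul0r.
Qed.

Lemma lift_isd (K K1 f : R -> R) : supported K -> supported K1 ->
  (forall tau : R, is_derive tau 1 K (K1 tau)) ->
  (forall t, I t -> derivable f t 1) ->
  forall tau : R, is_derive tau 1 (fun s => K s * f (b - s))
    (K1 tau * f (b - tau) - K tau * derive1 f (b - tau)).
Proof.
move=> sK sK1 dK df tau; have [Ib|nI] := pselect (I (b - tau)).
  have h0 := derivable_isd (df _ Ib).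
  have ha := isd_affine (-1) b tau.
  have E s : -1 * s + b = b - s by rewrite mulN1r addrC.
  rewrite -E in h0.
  have h := isd_mul (dK tau) (@isd_comp R f (fun s => -1 * s + b) tau _ _ h0 ha).
  have -> : (fun s => K s * f (b - s)) = (fun s => K s * f (-1 * s + b)).
    by apply/funext => s; rewrite E.
  apply: (@is_derive_eq _ _ _ _ _ _ _ _ h).
  by rewrite !E; ring.
have rt := ltW (supported_in nI).
rewrite (sK _ rt) (sK1 _ rt) !mul0r subrr.
apply: near_eq_is_derive (isd_cst 0 tau).
by have := supported_near0 sK nI; apply: filterS => s ->; rewrite mul0r.
Qed.

(** The cube of the positive part of r^2 - (tau - tau0)^2 has two continuous
    derivatives, as a test function requires; bump1 and bump2 are these. *)
Definition bump0 (tau : R) := pospow 3 (r ^+ 2 - (tau - tau0) ^+ 2).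
Definition bump1 (tau : R) :=
  - (6 * (tau - tau0)) * pospow 2 (r ^+ 2 - (tau - tau0) ^+ 2).
Definition bump2 (tau : R) :=
  - 6 * pospow 2 (r ^+ 2 - (tau - tau0) ^+ 2) +
  24 * (tau - tau0) ^+ 2 * pospow 1 (r ^+ 2 - (tau - tau0) ^+ 2).

Lemma isd_quad (tau : R) :
  is_derive tau 1 (fun s => r ^+ 2 - (s - tau0) ^+ 2) (- (2 * (tau - tau0))).
Proof.
have h1 := isd_affine 1 (- tau0) tau.
have h := isd_add (isd_cst (r ^+ 2) tau) (isd_mul (isd_cst (-1) tau) (isd_mul h1 h1)).
have -> : (fun s => r ^+ 2 - (s - tau0) ^+ 2) =
  fun s => r ^+ 2 + -1 * ((1 * s + - tau0) * (1 * s + - tau0)).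
  by apply/funext => s; ring.
by apply: (@is_derive_eq _ _ _ _ _ _ _ _ h); ring.
Qed.

Lemma isd_bump0 (tau : R) : is_derive tau 1 bump0 (bump1 tau).
Proof.
have h := @isd_comp R (pospow 3) (fun s => r ^+ 2 - (s - tau0) ^+ 2) tau _ _
  (@isd_pospow R 3 _ isT) (isd_quad tau).
by apply: (@is_derive_eq _ _ _ _ _ _ _ _ h); rewrite /bump1 /=; ring.
Qed.

Lemma isd_bump1 (tau : R) : is_derive tau 1 bump1 (bump2 tau).
Proof.
have h1 := @isd_comp R (pospow 2) (fun s => r ^+ 2 - (s - tau0) ^+ 2) tau _ _
  (@isd_pospow R 2 _ isT) (isd_quad tau).
have h := isd_mul (isd_affine (- 6) (6 * tau0) tau) h1.
have -> : bump1 = fun y => (- 6 * y + 6 * tau0) * pospow 2 (r ^+ 2 - (y - tau0) ^+ 2).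
  by apply/funext => s; rewrite /bump1; congr (_ * _); ring.
by apply: (@is_derive_eq _ _ _ _ _ _ _ _ h); rewrite /bump2 /=; ring.
Qed.

Lemma bump2_continuous : continuous bump2.
Proof.
move=> tau; have cq : {for tau, continuous (fun s => r ^+ 2 - (s - tau0) ^+ 2)}.
  exact: isd_continuous (isd_quad tau).
have cp n : {for tau, continuous (fun s => pospow n (r ^+ 2 - (s - tau0) ^+ 2))}.
  have cm : {for r ^+ 2 - (tau - tau0) ^+ 2, continuous (fun y : R => Num.max 0 y)}.
    by apply: (@continuous_max R R (fun=> 0) id); [exact: cst_continuous|exact: cvg_id].
  apply: (@continuous_comp _ _ _ _ (pospow n) _ cq).
  exact: (@continuous_comp _ _ _ (fun y : R => Num.max 0 y) _ _ cm
    (@exprn_continuous R n _)).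
apply: cvgD; apply: cvgM; [exact: cvg_cst|exact: cp| |exact: cp].
apply: cvgM; first exact: cvg_cst.
have ct : {for tau, continuous (fun s => s - tau0)}.
  by apply: cvgB; [exact: cvg_id|exact: cvg_cst].
exact: (@continuous_comp R R R (fun s => s - tau0) (fun y : R => y ^+ 2) tau ct
  (@exprn_continuous R 2 _)).
Qed.

Lemma pospow_supported n : (0 < n)%N ->
  supported (fun s => pospow n (r ^+ 2 - (s - tau0) ^+ 2)).
Proof.
move=> n0 tau rt; rewrite /pospow max_l ?expr0n ?gtn_eqF //.
rewrite subr_le0 -[leRHS]real_normK ?num_real //.
by rewrite lerXn2r ?nnegrE // ltW.
Qed.

Lemma bump_supported : [/\ supported bump0, supported bump1 & supported bump2].
Proof.
split => tau rt; rewrite /bump0 /bump1 /bump2 ?(pospow_supported _ rt) //; ring.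
Qed.

End Lift.

(** * Time reversal of viscosity solutions *)

Section LiftTest.
Context {R : realType} (a b tau0 r : R).
Hypothesis r0 : 0 < r.
Hypothesis rl : 0 < tau0 - r.
Hypothesis ru : tau0 + r < b - a.
Context (phi : R -> R -> R) (c : R).
Notation I := (`]a, b[%classic : set R).
Notation I' := (`]0, +oo[%classic : set R).
Hypothesis Cphi : Cb23 I phi.

Let K0 (tau : R) := r ^- 6 * bump0 tau0 r tau.
Let K1 (tau : R) := r ^- 6 * bump1 tau0 r tau.
Let K2 (tau : R) := r ^- 6 * bump2 tau0 r tau.

(** The time reversal of phi, interpolated with the constant c away from tau0.
    It is a test function for all positive times, while phi is controlled on
    ]a, b[ alone. *)
Definition lift_test (tau x : R) : R := (c - c * K0 tau) + K0 tau * phi (b - tau) x.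

Let sK : [/\ supported tau0 r K0, supported tau0 r K1 & supported tau0 r K2].
Proof.
have [s0 s1 s2] := bump_supported tau0 r0.
by split => tau rt; rewrite /K0 /K1 /K2 ?s0 ?s1 ?s2 // mulr0.
Qed.

Let dK0 (tau : R) : is_derive tau 1 K0 (K1 tau).
Proof.
have h := isd_mul (isd_cst (r ^- 6) tau) (isd_bump0 tau0 r tau).
by apply: (@is_derive_eq _ _ _ _ _ _ _ _ h); rewrite mul0r add0r.
Qed.

Let dK1 (tau : R) : is_derive tau 1 K1 (K2 tau).
Proof.
have h := isd_mul (isd_cst (r ^- 6) tau) (isd_bump1 tau0 r tau).
by apply: (@is_derive_eq _ _ _ _ _ _ _ _ h); rewrite mul0r add0r.
Qed.

Let cK : [/\ continuous K0, continuous K1 & continuous K2].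
Proof.
split => tau; [exact: isd_continuous (dK0 tau)|exact: isd_continuous (dK1 tau)|].
by apply: cvgM; [exact: cvg_cst|exact: bump2_continuous].
Qed.

Let phi_dt i t x : (i < 2)%N -> I t -> derivable (fun s => dt i phi s x) t 1.
Proof. by case: Cphi => H _ _ _; exact: H. Qed.

Let isd_lift_dt0 x (tau : R) : is_derive tau 1 (lift_test ^~ x)
  (- c * K1 tau + (K1 tau * phi (b - tau) x - K0 tau * dt 1 phi (b - tau) x)).
Proof.
have [s0 s1 _] := sK.
have h1 := lift_isd rl ru s0 s1 dK0 (fun t => @phi_dt 0 t x isT) tau.
have h2 := isd_add (isd_cst c tau) (isd_mul (isd_cst (- c) tau) (dK0 tau)).
have h := isd_add h2 h1.
have -> : lift_test ^~ x = fun s => c + - c * K0 s + K0 s * phi (b - s) x.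
  by apply/funext => s; rewrite /lift_test mulNr.
by apply: (@is_derive_eq _ _ _ _ _ _ _ _ h); rewrite mul0r !add0r.
Qed.

Let lift_dt1 : dt 1 lift_test = fun tau x =>
  - c * K1 tau + (K1 tau * phi (b - tau) x - K0 tau * dt 1 phi (b - tau) x).
Proof.
by apply/funext => tau; apply/funext => x; exact: isd_derive1 (isd_lift_dt0 x tau).
Qed.

Let isd_lift_dt1 x (tau : R) : is_derive tau 1 (fun s => dt 1 lift_test s x)
  (- c * K2 tau + (K2 tau * phi (b - tau) x - K1 tau * dt 1 phi (b - tau) x) -
   (K1 tau * dt 1 phi (b - tau) x - K0 tau * dt 2 phi (b - tau) x)).
Proof.
have [s0 s1 s2] := sK.
have h1 := lift_isd rl ru s1 s2 dK1 (fun t => @phi_dt 0 t x isT) tau.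
have h2 := lift_isd rl ru s0 s1 dK0 (fun t => @phi_dt 1 t x isT) tau.
have h := isd_add (isd_add (isd_mul (isd_cst (- c) tau) (dK1 tau)) h1)
  (isd_mul (isd_cst (-1) tau) h2).
have -> : (fun s => dt 1 lift_test s x) = (fun s => - c * K1 s + K1 s * phi (b - s) x +
    -1 * (K0 s * dt 1 phi (b - s) x)).
  by apply/funext => s; rewrite lift_dt1 mulN1r addrA.
by apply: (@is_derive_eq _ _ _ _ _ _ _ _ h); rewrite mul0r add0r mul0r add0r mulN1r.
Qed.

Let lift_dt2 : dt 2 lift_test = fun tau x =>
  - c * K2 tau + (K2 tau * phi (b - tau) x - K1 tau * dt 1 phi (b - tau) x) -
   (K1 tau * dt 1 phi (b - tau) x - K0 tau * dt 2 phi (b - tau) x).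
Proof.
by apply/funext => tau; apply/funext => x; exact: isd_derive1 (isd_lift_dt1 x tau).
Qed.

Let isd_lift_dx j tau (x : R) : (j < 3)%N ->
  is_derive x 1 (fun x => K0 tau * dx j phi (b - tau) x)
    (K0 tau * dx j.+1 phi (b - tau) x).
Proof.
move=> j3; have [Ib|nI] := pselect (I (b - tau)).
  case: Cphi => _ H _ _; have h0 := derivable_isd (H j _ x j3 Ib).
  have h := isd_mul (isd_cst (K0 tau) x) h0.
  by apply: (@is_derive_eq _ _ _ _ _ _ _ _ h); rewrite mul0r add0r.
have [s0 _ _] := sK.
have -> : K0 tau = 0 by apply: s0; exact: ltW (supported_in rl ru nI).
rewrite mul0r; have -> : (fun x => 0 * dx j phi (b - tau) x) = fun=> 0.
  by apply/funext => y; rewrite mul0r.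
exact: isd_cst.
Qed.

Let lift_dx j : (j < 3)%N ->
  dx j.+1 lift_test = fun tau x => K0 tau * dx j.+1 phi (b - tau) x.
Proof.
elim: j => [|j IH] j3; apply/funext => tau; apply/funext => x.
  have h := isd_add (isd_cst (c - c * K0 tau) x) (@isd_lift_dx 0 tau x j3).
  by rewrite [LHS](isd_derive1 h) add0r.
have -> : dx j.+2 lift_test tau x = derive1 (dx j.+1 lift_test tau) x by [].
rewrite IH ?(ltnW j3) //; exact: isd_derive1 (isd_lift_dx _ _ _).
Qed.

Lemma Cb23_lift_test : Cb23 I' lift_test.
Proof.
have [s0 s1 s2] := sK; have [c0 c1 c2] := cK.
have [_ _ bt bx] := Cphi.
have bK K : continuous K -> supported tau0 r K ->
    bounded_continuous_on (I' `*` setT) (fun t (x : R) => K t).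
  move=> cK' sK'; apply: bco_time => //.
  by have [C KC] := supported_bounded r0 cK' sK'; exists C.
have L K i : (i <= 2)%N -> continuous K -> supported tau0 r K ->
    bounded_continuous_on (I' `*` setT) (fun t x => K t * dt i phi (b - t) x).
  by move=> i2 cK' sK'; apply: (lift_bco r0 rl ru) => //; exact: bt.
have opp u : bounded_continuous_on (I' `*` setT) u ->
    bounded_continuous_on (I' `*` setT) (fun t x => - u t x).
  move=> bu; have -> : (fun t x => - u t x) = (fun t x => -1 * u t x).
    by apply/funext => t; apply/funext => x; rewrite mulN1r.
  by apply: bco_mul => //; exact: bco_cst.
have b0 : bounded_continuous_on (I' `*` setT) lift_test.
  apply: bco_add; last exact: (L K0 0).
  apply: bco_add; first exact: bco_cst.
  by apply: (opp (fun t x => c * K0 t)); apply: bco_mul; [exact: bco_cst|exact: bK].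
split.
- move=> [|[|//]] t x _ _; first exact: isd_derivable (isd_lift_dt0 x t).
  exact: isd_derivable (isd_lift_dt1 x t).
- move=> [|[|[|//]]] t x _ _.
  + exact: isd_derivable (isd_add (isd_cst (c - c * K0 t) x) (@isd_lift_dx 0 t x isT)).
  + rewrite (@lift_dx 0 isT); exact: isd_derivable (@isd_lift_dx 1 t x isT).
  + rewrite (@lift_dx 1 isT); exact: isd_derivable (@isd_lift_dx 2 t x isT).
- move=> [|[|[|//]]] _; first exact: b0.
  + rewrite lift_dt1; apply: bco_add.
      by apply: bco_mul; [exact: bco_cst|exact: bK].
    by apply: bco_add; [exact: (L K1 0)|exact: (opp _ (L K0 1 isT c0 s0))].
  + rewrite lift_dt2; apply: bco_add.
      apply: bco_add; first by apply: bco_mul; [exact: bco_cst|exact: bK].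
      by apply: bco_add; [exact: (L K2 0)|exact: (opp _ (L K1 1 isT c1 s1))].
    apply: (opp (fun t x => K1 t * dt 1 phi (b - t) x - K0 t * dt 2 phi (b - t) x)).
    by apply: bco_add; [exact: (L K1 1)|exact: (opp _ (L K0 2 isT c0 s0))].
- move=> [|j] j3; first exact: b0.
  by rewrite lift_dx //; apply: (lift_bco r0 rl ru) => //; exact: bx.
Qed.

Lemma lift_weight tau : 0 <= K0 tau <= 1.
Proof.
rewrite /K0 /bump0 /pospow; set q := r ^+ 2 - _.
have r2 : 0 < r ^+ 2 by rewrite exprn_gt0.
have r6 : 0 < r ^+ 6 by rewrite exprn_gt0.
have q0 : 0 <= Num.max 0 q by rewrite le_max lexx.
apply/andP; split; first by rewrite mulr_ge0 ?exprn_ge0 // invr_ge0 ltW.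
rewrite ler_pdivrMl // mulr1.
have -> : r ^+ 6 = (r ^+ 2) ^+ 3 by rewrite -exprM.
rewrite lerXn2r ?nnegrE ?(ltW r2) // ge_max (ltW r2) /=.
by rewrite /q gerBl sqr_ge0.
Qed.

Lemma lift_test_weight tau x : exists2 k, 0 <= k <= 1 &
  (~ I (b - tau) -> k = 0) /\ lift_test tau x = (1 - k) * c + k * phi (b - tau) x.
Proof.
exists (K0 tau); first exact: lift_weight.
split; last by rewrite /lift_test; ring.
by have [s0 _ _] := sK => nI; apply: s0; exact: ltW (supported_in rl ru nI).
Qed.

Lemma lift_test_touch : lift_test tau0 = phi (b - tau0) /\
  forall x, dt 1 lift_test tau0 x = - dt 1 phi (b - tau0) x.
Proof.
have r6 : r ^+ 6 != 0 by rewrite expf_neq0 // gt_eqF.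
have K01 : K0 tau0 = 1.
  rewrite /K0 /bump0 /pospow subrr expr0n /= subr0 max_r ?sqr_ge0 //.
  by rewrite -exprM mulVf.
have K10 : K1 tau0 = 0 by rewrite /K1 /bump1 subrr mulr0 oppr0 mul0r mulr0.
split; first by apply/funext => x; rewrite /lift_test K01; ring.
by move=> x; rewrite lift_dt1 K01 K10; ring.
Qed.

End LiftTest.

Section TimeReversal.
Context {R : realType} (al : R) (Km Kp : set R) (h : R) (psi : R -> R).
Notation I := (`](- h), (1 + h)[%classic : set R).
Notation J := (`](- h), (1 + h)]%classic : set R).
Notation I' := (`]0, +oo[%classic : set R).
Notation J' := (`[0, +oo[%classic : set R).

Lemma lift_radius t : I t -> exists r, [/\ 0 < r, 0 < 1 + h - t - r &
  1 + h - t + r < 1 + h - - h].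
Proof.
rewrite /= in_itv/= => /andP[t1 t2].
exists (Num.min (1 + h - t) (t + h) / 2).
have m0 : 0 < Num.min (1 + h - t) (t + h) by rewrite lt_min; apply/andP; split; lra.
have m1 : Num.min (1 + h - t) (t + h) <= 1 + h - t by rewrite ge_min lexx.
have m2 : Num.min (1 + h - t) (t + h) <= t + h by rewrite ge_min lexx orbT.
by split; lra.
Qed.

Lemma reversal_in_J t : J t -> J' (1 + h - t).
Proof. by rewrite /= !in_itv/= andbT subr_ge0 => /andP[]. Qed.

Lemma reversal_in_I t : I t -> I' (1 + h - t).
Proof. by rewrite /= !in_itv/= andbT subr_gt0 => /andP[]. Qed.

(** Time reversal turns the forward solution into a backward one. The forward
    notion tests against functions defined on an unbounded time interval: a
    backward test function is extended by a cut-off around the touching time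
    to a constant bound of the solution, which is still on the correct side. *)
Lemma time_reversal (u : R -> R -> R) : forward_solution al Km Kp psi u ->
  backward_solution al Km Kp h psi (fun t x => u (1 + h - t) x).
Proof.
move=> [[cu bu] [_ _ u0s subu] [_ _ u0S supu]].
have /bounded_onP [C uC] := bu.
have bv : [bounded unc (fun t x => u (1 + h - t) x) p | p in J `*` setT].
  apply/bounded_onP; exists C => -[t x] [Jt _].
  exact: (uC (1 + h - t, x) (conj (reversal_in_J Jt) Logic.I)).
have cv : {within J `*` setT, continuous (unc (fun t x => u (1 + h - t) x))}.
  apply/within_contP => t x [Jt _] e e0.
  have [d d0 H] := (within_contP (J' `*` setT) u).1 cu (1 + h - t) x
    (conj (reversal_in_J Jt) Logic.I) e e0.
  exists d => // s y [Js _] st yx; apply: H => //.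
    by split => //; exact: reversal_in_J.
  by rewrite opprD addrACA subrr add0r opprK addrC distrC.
have Tsub t : 1 + h - (1 + h - t) = t by rewrite subKr.
have lift t (phi : R -> R -> R) (c x : R) : I t -> Cb23 I phi ->
    exists Phi, [/\ Cb23 I' Phi, Phi (1 + h - t) = phi t,
      dt 1 Phi (1 + h - t) x = - dt 1 phi t x &
      forall tau y, exists2 k, 0 <= k <= 1 & (~ I (1 + h - tau) -> k = 0) /\
        Phi tau y = (1 - k) * c + k * phi (1 + h - tau) y].
  move=> It Cphi; have [r [r0 rl ru]] := lift_radius It.
  exists (lift_test (1 + h) (1 + h - t) r phi c).
  have [E1 E2] := lift_test_touch r0 rl ru c Cphi.
  split.
  - exact (Cb23_lift_test r0 rl ru c Cphi).
  - by rewrite E1 Tsub.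
  - by rewrite E2 Tsub.
  - by move=> tau y; exact: lift_test_weight r0 rl ru phi c _ _.
split; first by split.
- split => //; first exact: continuous_usc.
    by move=> x; rewrite subrr.
  move=> t x phi It Cphi uphi phix.
  have [Phi [CPhi PhiE PhidE Phiw]] := lift t phi C x It Cphi.
  have := subu (1 + h - t) x Phi (reversal_in_I It) CPhi.
  rewrite PhiE PhidE mul1r mulN1r; apply => // tau y It'.
  have [k /andP[k0 k1] [kI ->]] := Phiw tau y.
  have uC' : u tau y <= C.
    have J't : J' tau by move: It'; rewrite /= !in_itv/= !andbT; exact: ltW.
    exact: le_trans (ler_norm _) (uC (tau, y) (conj J't Logic.I)).
  have [Ib|nI] := pselect (I (1 + h - tau)).
    have := uphi _ y Ib; rewrite Tsub => up.
    have : (1 - k) * u tau y <= (1 - k) * C by rewrite ler_wpM2l // subr_ge0.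
    have : k * u tau y <= k * phi (1 + h - tau) y by rewrite ler_wpM2l.
    lra.
  by rewrite (kI nI) subr0 mul1r mul0r addr0.
- split => //; first exact: continuous_lsc.
    by move=> x; rewrite subrr.
  move=> t x phi It Cphi uphi phix.
  have [Phi [CPhi PhiE PhidE Phiw]] := lift t phi (- C) x It Cphi.
  have := supu (1 + h - t) x Phi (reversal_in_I It) CPhi.
  rewrite PhiE PhidE mul1r mulN1r; apply => // tau y It'.
  have [k /andP[k0 k1] [kI ->]] := Phiw tau y.
  have uC' : - C <= u tau y.
    have J't : J' tau by move: It'; rewrite /= !in_itv/= !andbT; exact: ltW.
    rewrite lerNl (le_trans (ler_norm _)) // normrN.
    exact: (uC (tau, y) (conj J't Logic.I)).
  have [Ib|nI] := pselect (I (1 + h - tau)).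
    have := uphi _ y Ib; rewrite Tsub => up.
    have : (1 - k) * - C <= (1 - k) * u tau y by rewrite ler_wpM2l // subr_ge0.
    have : k * phi (1 + h - tau) y <= k * u tau y by rewrite ler_wpM2l.
    lra.
  by rewrite (kI nI) subr0 mul1r mul0r addr0.
Qed.

End TimeReversal.

(** * The flow of the nonlinear Levy process *)

Section Flow.
Context {R : realType} (al : R) (Km Kp : set R) (S : sublinear_space R).
Context (X : R -> sOmega S -> R) (psi : R -> R).
Hypothesis hX : nonlinear_stable_levy al Km Kp X.

Definition flow (f : R -> R) (t x : R) : R := sE (fun w => f (x + X t w)).

Lemma sH_flow f t x : 0 <= t -> CbLip f -> sH (fun w => f (x + X t w)).
Proof.
move=> t0 Cf; apply: (sH_comp (g := fun y => f (x + y))); first exact: (nsl_H hX).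
have := CbLip_affine 1 x Cf; congr CbLip; apply/funext => y; by rewrite mul1r.
Qed.

Lemma flow0 f x : flow f 0 x = f x.
Proof.
rewrite /flow -[RHS](sE_cst S (f x)); congr sE; apply/funext => w.
by rewrite (nsl_0 hX) addr0.
Qed.

Lemma CbLip_trunc_norm (L C : R) : 0 <= L -> 0 <= C ->
  CbLip (fun y : R => Num.min (L * `|y|) C).
Proof.
move=> L0 C0; apply/CbLipP; split.
  exists C => x; rewrite ger0_norm ?ge_min ?lexx ?orbT //.
  by rewrite le_min C0 mulr_ge0.
exists L => // x y.
have H (a b : R) : `|Num.min a C - Num.min b C| <= `|a - b|.
  rewrite ler_norml; have := ler_norm (a - b); have := ler_norm (b - a).
  rewrite (distrC b a) => h1 h2; apply/andP; split; rewrite /Num.min;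
    case: ifP => a1; case: ifP => b1; lra.
rewrite (le_trans (H _ _)) // -mulrBr normrM (ger0_norm L0) ler_wpM2l //.
exact: ler_dist_dist.
Qed.

Hypothesis Cpsi : CbLip psi.

Lemma flow_bounded : exists2 C, 0 <= C & forall t x, 0 <= t -> `|flow psi t x| <= C.
Proof.
have /CbLipP [[C fC] _] := Cpsi; exists C; first exact: le_trans (fC 0).
by move=> t x t0; apply: sE_bound => //; exact: sH_flow.
Qed.

Lemma flow_lipschitz : exists2 L, 0 <= L &
  forall t x y, 0 <= t -> `|flow psi t x - flow psi t y| <= L * `|x - y|.
Proof.
have /CbLipP [_ [L L0 fL]] := Cpsi; exists L => // t x y t0.
apply: sE_dist_cst; try exact: sH_flow.
by move=> w; rewrite (le_trans (fL _ _)) // opprD addrACA subrr addr0.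
Qed.

(** The time modulus is uniform in space: by stationarity the increment over
    [s, t] is distributed as X (t - s), and the truncated first moment of the
    latter is itself a solution of the equation, continuous at time 0. *)
Lemma flow_time_continuous e : 0 < e -> exists2 d, 0 < d &
  forall s t x, 0 <= s -> 0 <= t -> `|s - t| < d ->
    `|flow psi s x - flow psi t x| <= e.
Proof.
move=> e0; have /CbLipP [[C fC] [L L0 fL]] := Cpsi.
have C0 : 0 <= 2 * C by have := le_trans (normr_ge0 _) (fC 0); lra.
pose eta (y : R) : R := Num.min (L * `|y|) (2 * C).
have Ceta : CbLip eta := CbLip_trunc_norm L0 C0.
have [[[cu _] _ _] _] := nsl_pde hX Ceta.
have J0 : ((`[0, +oo[%classic : set R) `*` [set: R]) (0, 0).
  by split => //=; rewrite in_itv/= lexx.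
have [d d0 Hd] := (within_contP _ (flow eta)).1 cu 0 0 J0 e e0.
have eta0 t : 0 <= t -> t < d -> sE (fun w => eta (X t w)) <= e.
  move=> t0 td.
  have Jt : ((`[0, +oo[%classic : set R) `*` [set: R]) (t, 0).
    by split => //=; rewrite in_itv/= t0.
  have := Hd t 0 Jt; rewrite !subr0 normr0 ger0_norm // => /(_ td d0).
  rewrite flow0 {2}/eta normr0 mulr0 min_l // subr0 => h.
  have -> : sE (fun w => eta (X t w)) = flow eta t 0.
    by rewrite /flow; congr sE; apply/funext => w; rewrite add0r.
  by rewrite (le_trans (ler_norm _)) // ltW.
exists d => //.
have main s t x : 0 <= s -> s <= t -> t - s < d -> `|flow psi s x - flow psi t x| <= e.
  move=> s0 st tsd; have t0 := le_trans s0 st; have ts0 : 0 <= t - s by rewrite subr_ge0.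
  apply: le_trans (eta0 _ ts0 tsd); rewrite -(nsl_stationary hX s0 st Ceta).
  apply: sE_dist; try exact: sH_flow.
    by apply: (sH_comp (g := eta)) => //; apply: sH_sub; exact: (nsl_H hX).
  move=> w; rewrite /eta le_min; apply/andP; split.
    by rewrite (le_trans (fL _ _)) // opprD addrACA subrr add0r distrC.
  by rewrite (le_trans (ler_normB _ _)) // mulr_natl mulr2n lerD.
move=> s t x s0 t0 std; have [st|/ltW ts] := leP s t.
  by apply: main => //; rewrite distrC ger0_norm ?subr_ge0 in std.
by rewrite distrC; apply: main => //; rewrite ger0_norm ?subr_ge0 in std.
Qed.

End Flow.

(** * Separable test functions *)

Section Separable.
Context {R : realType} (l u t A M : R) (Q : R -> R).
Notation I := (`]l, u[%classic : set R).
Hypothesis CQ : Cb 3 Q.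

Definition separable (s y : R) : R := (A * (s - t) + M * (s - t) ^+ 2) + Q y.

Let isd_q (s : R) : is_derive s 1 (fun s => A * (s - t) + M * (s - t) ^+ 2)
  (A + 2 * M * (s - t)).
Proof.
have h1 := isd_affine 1 (- t) s.
have h := isd_add (isd_mul (isd_cst A s) h1)
  (isd_mul (isd_cst M s) (isd_mul h1 h1)).
have -> : (fun s => A * (s - t) + M * (s - t) ^+ 2) =
    fun s => A * (1 * s + - t) + M * ((1 * s + - t) * (1 * s + - t)).
  by apply/funext => y; ring.
by apply: (@is_derive_eq _ _ _ _ _ _ _ _ h); ring.
Qed.

Lemma separable_dt1 : dt 1 separable = fun s y => A + 2 * M * (s - t).
Proof.
apply/funext => s; apply/funext => y.
have h := isd_add (isd_q s) (isd_cst (Q y) s).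
by rewrite [LHS](isd_derive1 h) addr0.
Qed.

Let isd_q1 (s : R) : is_derive s 1 (fun s => A + 2 * M * (s - t)) (2 * M).
Proof.
have h := isd_affine (2 * M) (A - 2 * M * t) s.
have -> // : (fun s => A + 2 * M * (s - t)) = fun s => 2 * M * s + (A - 2 * M * t).
by apply/funext => y; ring.
Qed.

Lemma separable_dt2 : dt 2 separable = fun s y => 2 * M.
Proof.
apply/funext => s; apply/funext => y.
have -> : dt 2 separable s y = derive1 (fun s => dt 1 separable s y) s by [].
by rewrite separable_dt1; exact: isd_derive1 (isd_q1 s).
Qed.

Lemma Cb_derive1n n m f : Cb (n + m) f -> Cb m (derive1n n f : R -> R).
Proof.
elim: n m => [//|n IH] m; rewrite addSnnS => /IH /Cb_derive [_ H].
exact: H.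
Qed.

Lemma separable_dx j : dx j.+1 separable = fun s y => derive1n j.+1 Q y.
Proof.
elim: j => [|j IH]; apply/funext => s; apply/funext => y.
  have [dQ _] := Cb_derive CQ.
  have h := isd_add (isd_cst (A * (s - t) + M * (s - t) ^+ 2) y) (dQ y).
  by rewrite [LHS](isd_derive1 h) add0r.
have -> : dx j.+2 separable s y = derive1 (dx j.+1 separable s) y by [].
by rewrite IH.
Qed.

Lemma Cb23_separable : Cb23 I separable.
Proof.
have bounded_time (f : R -> R) (k : R) :
    (forall s, I s -> `|f s| <= k) ->
    exists C, forall s x, (I `*` [set: R]) (s, x) -> `|f s| <= C.
  by move=> fk; exists k => s x [Is _]; exact: fk.
have sI s : I s -> `|s - t| <= `|u - l| + `|l - t|.
  rewrite /= in_itv/= => /andP[s1 s2].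
  have -> : s - t = (s - l) + (l - t) by ring.
  rewrite (le_trans (ler_normD _ _)) // lerD2r !ger0_norm ?subr_ge0 ?(ltW s1) //.
    by rewrite lerD2r ltW.
  by rewrite (ltW (lt_trans s1 s2)).
pose T := `|u - l| + `|l - t|.
have T0 : 0 <= T by rewrite addr_ge0.
have bco_dx j : (j <= 3)%N ->
    bounded_continuous_on (I `*` setT) (fun (s : R) y => derive1n j Q y).
  move=> j3; have C0 : Cb (3 - j) (derive1n j Q : R -> R).
    by apply: Cb_derive1n; rewrite subnKC.
  apply: bco_space; first by move=> y; exact: (Cb_continuous C0).
  exact: Cb_bounded C0.
have b0 : bounded_continuous_on (I `*` setT) separable.
  apply: bco_add; last exact: (bco_dx 0).
  apply: bco_time; first by move=> s; exact: isd_continuous (isd_q s).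
  apply: (bounded_time _ (`|A| * T + `|M| * T ^+ 2)) => s Is.
  rewrite (le_trans (ler_normD _ _)) // (normrM A) (normrM M) normrX.
  rewrite lerD // ler_wpM2l //; first exact: sI.
  by rewrite lerXn2r ?nnegrE //; exact: sI.
split.
- move=> [|[|//]] s y _ _.
    exact: isd_derivable (isd_add (isd_q s) (isd_cst (Q y) s)).
  by rewrite separable_dt1; exact: isd_derivable (isd_q1 s).
- move=> [|j] s y j3 _.
    have [dQ _] := Cb_derive CQ.
    exact: isd_derivable (isd_add (isd_cst (A * (s - t) + M * (s - t) ^+ 2) y) (dQ y)).
  rewrite separable_dx; have : Cb (3 - j.+1) (derive1n j.+1 Q : R -> R).
    by apply: Cb_derive1n; rewrite subnKC // ltnW.
  rewrite -(subnSK j3) => C1.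
  by have [dQ _] := Cb_derive C1; exact: isd_derivable (dQ y).
- move=> [|[|[|//]]] _; first exact: b0.
    rewrite separable_dt1; apply: bco_time.
      by move=> s; exact: isd_continuous (isd_q1 s).
    apply: (bounded_time _ (`|A| + `|2 * M| * T)) => s Is.
    rewrite (le_trans (ler_normD _ _)) // lerD2l normrM ler_wpM2l //; exact: sI.
  by rewrite separable_dt2; exact: bco_cst.
- move=> [|j] j3; first exact: b0.
  by rewrite separable_dx; exact: bco_dx.
Qed.

End Separable.

Section TaylorTame.
Context {R : realType}.

(** Quadratic near 0 by Taylor expansion, linear at infinity because P is
    Lipschitz. *)
Lemma Cb_tame (P : R -> R) x : Cb 2 P ->
  exists2 K, 0 <= K & forall z, `|delta P x z| <= K * tame z.
Proof.
move=> CP; have [dP /[dup] CP1 /Cb_derive [dP1 CP2]] := Cb_derive CP.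
have [C1 PC1] := Cb_bounded CP1; have [C2 PC2] := Cb_bounded CP2.
have C10 : 0 <= C1 by exact: le_trans (PC1 0).
have C20 : 0 <= C2 by exact: le_trans (PC2 0).
have mvt (f df : R -> R) (y z C : R) : (forall s : R, is_derive s 1 f (df s)) ->
    (forall s, `|df s| <= C) -> `|f y - f z| <= C * `|y - z|.
  move=> fd dfC; have [yz|/ltW zy] := leP y z.
    have [c _ E] := MVT_isd fd yz.
    by rewrite distrC E normrM (distrC z) ler_wpM2r.
  by have [c _ E] := MVT_isd fd zy; rewrite E normrM ler_wpM2r.
have dd (s : R) : is_derive s 1 (fun z => delta P x z) (derive1 P (x + s) - derive1 P x).
  have h1 := @isd_comp R P (fun z => 1 * z + x) s _ _ (dP (1 * s + x)) (isd_affine 1 x s).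
  have h := isd_add h1 (isd_affine (- derive1 P x) (- P x) s).
  have -> : (fun z => delta P x z) =
      (fun z => P (1 * z + x) + (- derive1 P x * z + - P x)).
    by apply/funext => z; rewrite /delta mul1r (addrC x z); ring.
  by apply: (@is_derive_eq _ _ _ _ _ _ _ _ h); rewrite mulr1 mul1r (addrC x s).
have d0 : delta P x 0 = 0 by rewrite /delta addr0 mulr0; ring.
exists (C2 + 2 * C1) => [|z]; first by rewrite addr_ge0 // mulr_ge0.
have b1 : `|delta P x z| <= 2 * C1 * `|z|.
  rewrite -[delta P x z]subr0 -d0 -{2}[z]subr0; apply: mvt dd _ => s.
  by rewrite (le_trans (ler_normB _ _)) // mulr_natl mulr2n lerD.
have b2 : `|delta P x z| <= C2 * z ^+ 2.
  have b2' (y : R) : `|y| <= `|z| -> `|derive1 P (x + y) - derive1 P x| <= C2 * `|z|.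
    move=> yz; rewrite (le_trans (mvt _ _ _ _ _ dP1 PC2)) // addrAC subrr add0r.
    by rewrite ler_wpM2l.
  rewrite -(real_normK (num_real z)) expr2 mulrA.
  have [z0|z0] := leP 0 z.
    have [c /andP[c0 cz] E] := MVT_isd dd z0.
    rewrite d0 subr0 subr0 in E; rewrite E normrM ler_wpM2r // b2' //.
    by rewrite !ger0_norm.
  have [c /andP[cz c0] E] := MVT_isd dd (ltW z0).
  rewrite d0 sub0r sub0r in E; rewrite -normrN E normrM normrN ler_wpM2r // b2' //.
  by rewrite !ler0_norm ?(ltW z0) // lerN2.
rewrite /tame /Num.min; case: ifP => _.
  by rewrite (le_trans b2) // ler_wpM2r ?sqr_ge0 // lerDl mulr_ge0.
by rewrite (le_trans b1) // ler_wpM2r // lerDr.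
Qed.

End TaylorTame.

(** * Touching a viscosity solution *)

Section Touching.
Context {R : realType} (al lam Lam : R) (Km Kp : set R).
Hypothesis al1 : 1 < al.
Hypothesis al2 : al < 2.
Hypothesis lam0 : 0 < lam.
Hypothesis lamLam : lam < Lam.
Hypothesis KmI : Km `<=` `]lam, Lam[.
Hypothesis KpI : Kp `<=` `]lam, Lam[.
Context (h : R) (psi : R -> R) (v : R -> R -> R).
Notation I := (`](- h), (1 + h)[%classic : set R).
Hypothesis hv : backward_solution al Km Kp h psi v.
Context (C L : R).
Hypothesis vC : forall s y, I s -> `|v s y| <= C.
Hypothesis vL : forall s x y, I s -> `|v s x - v s y| <= L * `|x - y|.
Hypothesis vT : forall e : R, 0 < e -> exists2 d : R, 0 < d &
  forall s t x, I s -> I t -> `|s - t| < d -> `|v s x - v t x| <= e.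
Notation mu := (@lebesgue_measure R).

(** For s close to t the uniform modulus in time suffices, and for the other s
    a large M beats the bound on v: a parabola in time can absorb the whole
    variation of v in time. *)
Lemma time_parabola t A e : I t -> 0 < e -> exists M, forall s y, I s ->
  `|v s y - v t y| + A * `|s - t| <= e + M * (s - t) ^+ 2.
Proof.
move=> It e0; have e2 : 0 < e / 2 by rewrite divr_gt0.
have [d d0 Hd] := vT e2.
pose d1 := Num.min d (e / (2 * (`|A| + 1))).
have A1 : 0 < `|A| + 1 by rewrite ltr_wpDl.
have d10 : 0 < d1 by rewrite lt_min d0 divr_gt0 // mulr_gt0.
have C0 : 0 <= C by exact: le_trans (vC 0 It).
exists (2 * C / d1 ^+ 2 + `|A| / d1) => s y Is.
have sq : (s - t) ^+ 2 = `|s - t| ^+ 2 by rewrite real_normK ?num_real.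
have Ah : A * `|s - t| <= `|A| * `|s - t| by rewrite ler_wpM2r // ler_norm.
have [st|st] := ltP `|s - t| d1.
  move: st; rewrite lt_min => /andP[st1 st2].
  have h1 := Hd s t y Is It st1.
  have h2 : `|A| * `|s - t| <= e / 2.
    apply: (@le_trans _ _ ((`|A| + 1) * (e / (2 * (`|A| + 1))))).
      by rewrite ler_pM ?lerDl // ltW.
    by rewrite le_eqVlt; apply/orP; left; apply/eqP; field; lra.
  have h3 : 0 <= (2 * C / d1 ^+ 2 + `|A| / d1) * (s - t) ^+ 2.
    by rewrite mulr_ge0 ?sqr_ge0 // addr_ge0 // ?divr_ge0 ?mulr_ge0 ?sqr_ge0 // ltW.
  lra.
have h1 : `|v s y - v t y| <= 2 * C.
  by rewrite (le_trans (ler_normB _ _)) // mulr_natl mulr2n lerD ?vC.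
have h2 : 2 * C <= 2 * C / d1 ^+ 2 * (s - t) ^+ 2.
  rewrite -mulrA ler_peMr ?mulr_ge0 // ler_pdivlMl ?exprn_gt0 // mulr1 sq.
  by rewrite lerXn2r ?nnegrE // ltW.
have h3 : `|A| * `|s - t| <= `|A| / d1 * (s - t) ^+ 2.
  rewrite -mulrA ler_wpM2l // ler_pdivlMl // sq expr2 ler_wpM2r //.
rewrite mulrDl; lra.
Qed.

Lemma v_continuous t : I t -> continuous (v t).
Proof.
move=> It x; apply/cvgrPdist_le => e e0.
have L0 : 0 <= L by have := vL 1 0 It; rewrite subr0 normr1 mulr1; exact: le_trans.
near=> y; rewrite (le_trans (vL _ _ It)) //.
have : `|x - y| <= e / (L + 1).
  by near: y; apply: cvgr_dist_le; [exact: cvg_id|rewrite divr_gt0 // ltr_wpDl].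
rewrite ler_pdivlMr ?ltr_wpDl //; have := normr_ge0 (x - y); nra.
Unshelve. all: by end_near. Qed.

Context (sg : R).
Hypothesis sgE : sg = 1 \/ sg = -1.

Let sgsg : sg * sg = 1. Proof. by case: sgE => ->; rewrite ?mulr1 ?mulrNN ?mulr1. Qed.
Let nsg : `|sg| = 1. Proof. by case: sgE => ->; rewrite ?normrN normr1. Qed.

(** The subsolution property for sg = 1, the supersolution property for
    sg = -1: multiplied by sg, both test functions lie above sg v, with the
    slope A in time. *)
Lemma viscosity_separable t x A M (Q : R -> R) (r e : R) : I t -> Cb 3 Q ->
  sg * v t x = Q x ->
  (forall s y, I s -> sg * v s y <= A * (s - t) + M * (s - t) ^+ 2 + Q y) ->
  (levy_sup al Km Kp (fun y => sg * Q y)%R x <= (r + e)%:E)%E ->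
  ((r - e)%:E <= levy_sup al Km Kp (fun y => sg * Q y)%R x)%E ->
  - A <= sg * r + e.
Proof.
move=> It CQ Qx Qv hup hlo.
have CsQ : Cb 3 (fun y => sg * Q y) by apply: Cb_mul => //; exact: Cb_cst.
pose phi := separable t (sg * A) (sg * M) (fun y => sg * Q y).
have Cphi : Cb23 I phi by exact: Cb23_separable.
have phit : phi t = fun y => sg * Q y.
  by apply/funext => y; rewrite /phi /separable subrr expr0n /= !mulr0 !add0r.
have phix : phi t x = v t x by rewrite phit -Qx mulrA sgsg mul1r.
have dphi : dt 1 phi t x = sg * A by rewrite separable_dt1 subrr mulr0 addr0.
have phiE s y : phi s y = sg * (A * (s - t) + M * (s - t) ^+ 2 + Q y).
  by rewrite /phi /separable; ring.
have [_ [_ _ _ sub] [_ _ _ sup]] := hv.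
have le_phi s y : I s -> sg * v s y <= sg * phi s y.
  by move=> Is; rewrite phiE mulrA sgsg mul1r; exact: Qv.
have [q qE] : exists q, levy_sup al Km Kp (fun y => sg * Q y) x = q%:E.
  by move: hup hlo; case: levy_sup => // q _ _; exists q.
move: hup hlo; rewrite qE !lee_fin => hup hlo.
case: sgE => sgv.
- have : forall s y, I s -> v s y <= phi s y.
    by move=> s y /(le_phi s y); rewrite sgv !mul1r.
  move=> /(sub t x phi It Cphi)/(_ phix); rewrite dphi phit qE -EFinB lee_fin sgv; lra.
- have : forall s y, I s -> phi s y <= v s y.
    by move=> s y /(le_phi s y); rewrite sgv !mulN1r lerN2.
  move=> /(sup t x phi It Cphi)/(_ phix); rewrite dphi phit qE -EFinB lee_fin sgv; lra.
Qed.

(** If sg v is touched from above at (t, x), globally, by a profile P in space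
    and a parabola in time, then the slope obeys the equation with the value r
    of the operator at v itself. The test function has to be close to sg v away
    from x for its operator to be close to r: the profile P is blended, with a
    weight concentrated at x, into a smooth function lying just above sg v. *)
Lemma touching_slope t x A M (P : R -> R) (r : R) : I t -> Cb 3 P ->
  (forall s y, I s ->
    sg * v s y <= sg * v t x + (A * (s - t) + M * (s - t) ^+ 2) + (P y - P x)) ->
  levy_sup al Km Kp (v t) x = r%:E ->
  - A <= sg * r.
Proof.
move=> It CP HP Lv.
have Lam0 : 0 < Lam by exact: lt_trans lamLam.
have cv := v_continuous It.
have mdv := measurable_delta x cv.
have idv : mu.-integrable [set: R] (fun z => (delta (v t) x z * nu al z)%:E).
  by apply: (levy_sup_integrable al1 lam0 KmI KpI) => //; rewrite Lv.
pose w y := sg * v t y.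
have cP := Cb_continuous CP.
have [dP _] := Cb_derive CP.
have [K K0 PK] := Cb_tame x (CbS CP).
pose E z := P (x + z) - P x - (w (x + z) - w x).
have E0 z : 0 <= E z.
  have := HP t (x + z) It; rewrite subrr expr0n /= !mulr0 addr0 addr0 -/(w x) -/(w (x + z)).
  rewrite /E; lra.
pose p := derive1 P x; pose c := derive1 (v t) x.
have EE z : E z = delta P x z - sg * delta (v t) x z + (p - sg * c) * z.
  by rewrite /E /delta /w /p /c; ring.
have pc : p = sg * c.
  suff : - (p - sg * c) = 0 by move/eqP; rewrite oppr_eq0 subr_eq0 => /eqP.
  apply: (slope_eq0 (K := K) al1 al2 mdv idv) => z _.
  have h1 := E0 z; rewrite EE in h1.
  have h2 : delta P x z <= K * z ^+ 2.
    rewrite (le_trans (ler_norm _)) // (le_trans (PK z)) // ler_wpM2l //.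
    by rewrite /tame ge_min lexx.
  have h3 : - (sg * delta (v t) x z) <= `|delta (v t) x z|.
    by rewrite -[leRHS]mul1r -nsg -normrM -normrN ler_norm.
  rewrite mulNr; lra.
have {}EE z : E z = delta P x z - sg * delta (v t) x z.
  by rewrite EE pc subrr mul0r addr0.
have mE : measurable_fun [set: R] E.
  have -> : E = fun z => delta P x z - sg * delta (v t) x z by apply/funext.
  apply: measurable_funB; first exact: measurable_delta.
  exact: measurable_funM.
have iE : mu.-integrable [set: R] (fun z => (E z * nu al z)%:E).
  have i1 := integrableZl measurableT K (tame_nu_integrable al1 al2).
  have i2 := integrableD measurableT i1 (integrable_abse idv).
  apply: (@le_integrable _ _ R mu [set: R] measurableT _ _ _ _ i2).
    by apply/measurable_EFinP; apply: measurable_funM => //; exact: measurable_nu.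
  move=> z _; rewrite /= lee_fin.
  rewrite [leRHS]ger0_norm; last first.
    by rewrite addr_ge0 // mulr_ge0 // mulr_ge0 ?tame_ge0 ?nu_ge0.
  rewrite (normrM (E z)) (normrM (delta _ _ _)) (ger0_norm (nu_ge0 al z)) mulrA -mulrDl.
  rewrite ler_wpM2r ?nu_ge0 // EE (le_trans (ler_normB _ _)) // normrM nsg mul1r.
  by rewrite lerD2r.
apply/ler_addgt0Pr => e e0.
have eL0 : 0 < e / Lam by rewrite divr_gt0.
have [j [j0 iD De]] := concentrating_integral_small al1 al2 mE E0 iE eL0.
have jR : 1 <= j%:R :> R by rewrite ler1n.
have jR0 : 0 < j%:R :> R by rewrite ltr0n.
(* the smooth majorant W of sg v has to satisfy W - sg v <= j^-3 = 3 eps, so that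
   (1 - chi) (W - sg v) <= tame / j *)
pose eps : R := (j%:R ^+ 3)^-1 / 3.
have eps0 : 0 < eps by rewrite divr_gt0 // invr_gt0 exprn_gt0.
have wL y z : `|w y - w z| <= L * `|y - z|.
  by rewrite /w -mulrBr normrM nsg mul1r vL.
have wC : exists B, forall y, `|w y| <= B.
  by exists C => y; rewrite normrM nsg mul1r vC.
have [W0 CW0 W0w] := smooth_approx eps0 wC wL.
pose W y := W0 y + 2 * eps.
have CW : Cb 3 W by apply: Cb_add => //; exact: Cb_cst.
have Wlo y : w y + eps <= W y.
  by have := W0w y; rewrite ler_distl /W => /andP[h1 h2]; lra.
have Whi y : W y <= w y + (j%:R ^+ 3)^-1.
  have := W0w y; rewrite ler_distl /W => /andP[h1 h2].
  have <- : eps * 3 = (j%:R ^+ 3)^-1 by rewrite /eps divfK // pnatr_eq0.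
  lra.
have [M1 HM1] := time_parabola `|A| It eps0.
pose M2 := Num.max M M1.
pose chi y := zeta (j%:R * y + - (j%:R * x)).
have Cchi : Cb 3 chi by apply: Cb_affine; have [] := @Cb_zeta_theta R 3.
have chi01 y : 0 <= chi y <= 1.
  by rewrite /chi; have /andP[/ltW -> ->] := zeta_bound (j%:R * y + - (j%:R * x)).
have chix : chi x = 1 by rewrite /chi subrr /zeta expr0n /= addr0 invr1.
pose P1 y := (w x + - P x) + P y.
have CP1 : Cb 3 P1 by apply: Cb_add => //; exact: Cb_cst.
pose Q y := W y + chi y * (P1 y + -1 * W y).
have CQ : Cb 3 Q.
  apply: Cb_add => //; apply: Cb_mul => //; apply: Cb_add => //.
  by apply: Cb_mul => //; exact: Cb_cst.
have Qx : Q x = w x by rewrite /Q chix /P1; ring.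
have Qv s y : I s -> sg * v s y <= A * (s - t) + M2 * (s - t) ^+ 2 + Q y.
  move=> Is; have sq : 0 <= (s - t) ^+ 2 by exact: sqr_ge0.
  have MM2 : M * (s - t) ^+ 2 <= M2 * (s - t) ^+ 2 by rewrite ler_wpM2r // le_max lexx.
  have M1M2 : M1 * (s - t) ^+ 2 <= M2 * (s - t) ^+ 2.
    by rewrite ler_wpM2r // le_max lexx orbT.
  have hP : sg * v s y <= A * (s - t) + M2 * (s - t) ^+ 2 + P1 y.
    by have := HP s y Is; rewrite -/(w x) /P1; lra.
  have hW : sg * v s y <= A * (s - t) + M2 * (s - t) ^+ 2 + W y.
    have := HM1 s y Is.
    have : sg * v s y - w y <= `|v s y - v t y|.
      by rewrite /w -mulrBr -[leRHS]mul1r -nsg -normrM ler_norm.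
    have : - (A * (s - t)) <= `|A| * `|s - t| by rewrite -normrM -normrN ler_norm.
    have := Wlo y; lra.
  have /andP[c0 c1] := chi01 y.
  rewrite /Q; nra.
have dQ : derive1 Q x = p.
  have hc := @isd_comp R zeta (fun y => j%:R * y + - (j%:R * x)) x _ _
    (isd_zeta _) (isd_affine j%:R (- (j%:R * x)) x).
  have [dW _] := Cb_derive CW.
  have hP1 := isd_add (isd_cst (w x + - P x) x) (dP x).
  have hd := isd_add (dW x) (isd_mul hc (isd_add hP1 (isd_mul (isd_cst (-1) x) (dW x)))).
  rewrite (isd_derive1 hd) -/(chi x) chix subrr /theta mul0r; rewrite -/p; ring.
have nD z : `|delta (fun y => sg * Q y) x z - delta (v t) x z| <=
    (1 + (j%:R * z) ^+ 2)^-1 * E z + j%:R^-1 * tame z.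
  have -> : delta (fun y => sg * Q y) x z - delta (v t) x z =
      sg * (chi (x + z) * E z + (1 - chi (x + z)) * (W (x + z) - w (x + z))).
    have dsQ : derive1 (fun y => sg * Q y) x = sg * p.
      have [dQ' _] := Cb_derive CQ.
      have hd := isd_mul (isd_cst sg x) (dQ' x).
      by rewrite (isd_derive1 hd) dQ mul0r add0r.
    rewrite /delta dsQ Qx -/c pc /E /w.
    have vE y : v t y = sg * (sg * v t y) by rewrite mulrA sgsg mul1r.
    rewrite [in X in _ - X](vE (x + z)) [in X in _ - X](vE x).
    have -> : sg * (sg * c) = c by rewrite mulrA sgsg mul1r.
    by rewrite /Q /P1 /w; ring.
  have /andP[c0 c1] := chi01 (x + z).
  have Ww0 : 0 <= W (x + z) - w (x + z) by have := Wlo (x + z); lra.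
  rewrite normrM nsg mul1r ger0_norm; last first.
    by rewrite addr_ge0 // mulr_ge0 // subr_ge0.
  have chiE : chi (x + z) = (1 + (j%:R * z) ^+ 2)^-1.
    by rewrite /chi /zeta; congr (1 + _ ^+ 2)^-1; ring.
  rewrite -chiE lerD2l.
  apply: (@le_trans _ _ ((1 - chi (x + z)) * (j%:R ^+ 3)^-1)).
    by rewrite ler_wpM2l ?subr_ge0 //; have := Whi (x + z); lra.
  have den1 : 0 < 1 + (j%:R * z) ^+ 2 by exact: den_gt0.
  have b1 : (1 - chi (x + z)) * (j%:R ^+ 3)^-1 <= j%:R^-1 * z ^+ 2.
    have : 1 - chi (x + z) <= (j%:R * z) ^+ 2.
      have -> : 1 - chi (x + z) = chi (x + z) * (j%:R * z) ^+ 2.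
        by rewrite chiE; field; rewrite gt_eqF.
      by rewrite ler_piMl // sqr_ge0.
    move=> h1; apply: (@le_trans _ _ ((j%:R * z) ^+ 2 * (j%:R ^+ 3)^-1)).
      by rewrite ler_wpM2r // invr_ge0 exprn_ge0.
    by rewrite le_eqVlt; apply/orP; left; apply/eqP; field; rewrite gt_eqF.
  have b2 : (1 - chi (x + z)) * (j%:R ^+ 3)^-1 <= j%:R^-1.
    rewrite -[leRHS]mul1r ler_pM ?subr_ge0 ?invr_ge0 ?exprn_ge0 //; first lra.
    by rewrite lef_pV2 ?posrE ?exprn_gt0 // -[leLHS]expr1 ler_weXn2l.
  rewrite /tame; have [z1|z1] := leP `|z| 1.
    rewrite min_l // -real_normK ?num_real // expr2.
    by rewrite ler_piMl.
  apply: (le_trans b2); rewrite ler_peMr ?invr_ge0 //.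
  by rewrite le_min (ltW z1) -real_normK ?num_real // expr_ge1 // ltW.
have mD : measurable_fun [set: R]
    (fun z => (1 + (j%:R * z) ^+ 2)^-1 * E z + j%:R^-1 * tame z).
  apply: measurable_funD; apply: measurable_funM => //; last exact: measurable_tame.
  apply: continuous_measurable_fun => z.
  have -> : (fun z : R => (1 + (j%:R * z) ^+ 2)^-1) = fun z => zeta (j%:R * z + 0).
    by apply/funext => y; rewrite addr0.
  exact: (isd_continuous (@isd_comp R zeta (fun y => j%:R * y + 0) z _ _
    (isd_zeta _) (isd_affine j%:R 0 z))).
have csQ : continuous (fun y => sg * Q y).
  by apply: (@Cb_continuous R 3); apply: Cb_mul => //; exact: Cb_cst.
have [h1 h2] := levy_sup_perturb al1 lam0 KmI KpI csQ cv mD nD iD De Lv.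
have eE : Lam * (e / Lam) = e by rewrite mulrCA divff ?mulr1 // gt_eqF.
rewrite eE in h1 h2.
exact: viscosity_separable It CQ (esym Qx) Qv h1 h2.
Qed.

End Touching.

(** * Comparison along a vertical line *)

Section Penalties.
Context {R : realType}.

(** A bounded substitute for z^2 as a penalty in space. *)
Definition rho (z : R) : R := 1 - zeta z.

Lemma rho01 z : 0 <= rho z <= 1.
Proof. by rewrite /rho; have /andP[h1 h2] := zeta_bound z; apply/andP; split; lra. Qed.

Lemma rho0 : rho 0 = 0.
Proof. by rewrite /rho /zeta expr0n /= addr0 invr1 subrr. Qed.

Lemma rho_le (r z : R) : 0 <= r -> r <= `|z| -> rho r <= rho z.
Proof.
move=> r0 rz; rewrite /rho lerD2l lerN2 /zeta lef_pV2 ?posrE ?den_gt0 // lerD2l.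
by rewrite -[leRHS]real_normK ?num_real // lerXn2r ?nnegrE.
Qed.

Lemma rho_gt0 (r : R) : 0 < r -> 0 < rho r.
Proof.
move=> r0; rewrite /rho subr_gt0 /zeta invf_lt1 ?den_gt0 // ltrDl.
by rewrite exprn_gt0.
Qed.

Lemma rho_continuous : continuous rho.
Proof.
move=> z; apply: cvgB; first exact: cvg_cst.
exact: (isd_continuous (isd_zeta z)).
Qed.

(** The singular penalty 1 / (s - t1) lies below a parabola tangent to it, which
    is admissible in a test function. *)
Lemma inv_parabola (q y : R) : 0 < q -> q / 2 <= y ->
  y^-1 <= q^-1 - (y - q) / q ^+ 2 + 2 / q ^+ 3 * (y - q) ^+ 2.
Proof.
move=> q0 qy; have y0 : 0 < y by apply: lt_le_trans qy; rewrite divr_gt0.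
rewrite -subr_ge0.
have -> : q^-1 - (y - q) / q ^+ 2 + 2 / q ^+ 3 * (y - q) ^+ 2 - y^-1 =
    (y - q) ^+ 2 * (2 * y - q) / (q ^+ 3 * y).
  by field; rewrite !gt_eqF.
apply: divr_ge0; first by rewrite mulr_ge0 ?sqr_ge0 //; lra.
by rewrite mulr_ge0 ?exprn_ge0 // ltW.
Qed.

End Penalties.

(** Comparison in time along a vertical line. If sg v decreased faster than
    the bound m on the operator allows, then a maximum of the penalized
    function would be a touching point with too steep a slope. The penalty
    kap / (s - t1) keeps the maximum away from t1 and only steepens the slope;
    the penalty k rho keeps it near x0. *)
Lemma time_comparison {R : realType} (al lam Lam : R) (Km Kp : set R) (h : R)
  (psi : R -> R) (v ell : R -> R -> R) (C L sg : R) :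
  1 < al -> al < 2 -> 0 < lam -> lam < Lam ->
  Km `<=` `]lam, Lam[ -> Kp `<=` `]lam, Lam[ -> 0 < h ->
  backward_solution al Km Kp h psi v ->
  let I := `](- h), (1 + h)[%classic : set R in
  (forall s y, I s -> `|v s y| <= C) ->
  (forall s x y, I s -> `|v s x - v s y| <= L * `|x - y|) ->
  (forall e : R, 0 < e -> exists2 d : R, 0 < d &
    forall s t x, I s -> I t -> `|s - t| < d -> `|v s x - v t x| <= e) ->
  (forall t x, 0 <= t -> t <= 1 -> levy_sup al Km Kp (v t) x = (ell t x)%:E) ->
  sg = 1 \/ sg = -1 ->
  forall t1 t2 x0 m rad, 0 <= t1 -> t1 < t2 -> t2 <= 1 -> 0 < rad ->
  (forall t x, t1 <= t -> t <= t2 -> `|x - x0| <= rad -> sg * ell t x <= m) ->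
  sg * v t1 x0 - sg * v t2 x0 <= m * (t2 - t1).
Proof.
move=> al1 al2 lam0 lamLam KmI KpI h0 hv I vC vL vT vell sgE.
move=> t1 t2 x0 m rad t10 t12 t21 rad0 ellm.
have nsg : `|sg| = 1 by case: sgE => ->; rewrite ?normrN normr1.
rewrite leNgt; apply/negP => contra.
have It s : t1 <= s -> s <= t2 -> I s.
  move=> s1 s2; rewrite /I /= in_itv/=; apply/andP; split.
    by rewrite (lt_le_trans (y := 0)) ?oppr_lt0 // (le_trans t10).
  by rewrite (le_lt_trans s2) // (le_lt_trans t21) // ltrDl.
have It1 : I t1 by apply: It => //; exact: ltW.
have It2 : I t2 by apply: It => //; exact: ltW.
have C0 : 0 <= C by exact: le_trans (vC _ 0 It1).
have L0 : 0 <= L by have := vL _ 1 0 It1; rewrite subr0 normr1 mulr1; exact: le_trans.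
have [w wE] : exists w : R -> R -> R, forall s y, w s y = sg * v s y.
  by exists (fun s y => sg * v s y).
rewrite -!wE in contra.
have wC s y : I s -> `|w s y| <= C by move=> Is; rewrite wE normrM nsg mul1r vC.
have wL s x y : I s -> `|w s x - w s y| <= L * `|x - y|.
  by move=> Is; rewrite !wE -mulrBr normrM nsg mul1r vL.
have [T TE] : exists T, T = t2 - t1 by exists (t2 - t1).
have T0 : 0 < T by rewrite TE subr_gt0.
(* d is a quarter of the excess, m' a slightly larger slope still exceeded *)
have [d [m' [d0 mm' f12]]] : exists d m', [/\ 0 < d, m < m' &
    w t1 x0 + m' * t1 = w t2 x0 + m' * t2 + 3 * d].
  pose d := (w t1 x0 - w t2 x0 - m * T) / 4; exists d, (m + d / T).
  have d0 : 0 < d by rewrite divr_gt0 // subr_gt0 TE.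
  split => //; first by rewrite ltrDl divr_gt0.
  have : d * 4 = w t1 x0 - w t2 x0 - m * T by rewrite /d divfK.
  have : (m + d / T) * t2 - (m + d / T) * t1 = m * T + d.
    by rewrite -mulrBr -TE mulrDl divfK // gt_eqF.
  move: (w t1 x0) (w t2 x0) ((m + d / T) * t1) ((m + d / T) * t2) (m * T) (d).
  by clear; move=> *; lra.
clear contra.
have d20 : 0 < d / 2 by rewrite divr_gt0.
have [d1 d10 Hd1] := vT _ d20.
(* a delay g after t1 during which the decrease stays visible *)
have [g [g0 gT gd1 gm]] : exists g, [/\ 0 < g, g <= T / 2, g < d1 & `|m'| * g <= d / 2].
  exists (Num.min (T / 2) (Num.min (d1 / 2) (d / (2 * (`|m'| + 1))))).
  have M1 : 0 < `|m'| + 1 by rewrite ltr_wpDl.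
  have T2 : 0 < T / 2 by rewrite divr_gt0.
  have d12 : 0 < d1 / 2 by rewrite divr_gt0.
  have g0 : 0 < Num.min (T / 2) (Num.min (d1 / 2) (d / (2 * (`|m'| + 1)))).
    by rewrite !lt_min T2 d12 divr_gt0 // mulr_gt0.
  split => //.
  - by rewrite ge_min lexx.
  - apply: (@le_lt_trans _ _ (d1 / 2)); first by rewrite !ge_min lexx !orbT.
    by rewrite ltr_pdivrMr // mulr_natr mulr2n ltrDl.
  - apply: (@le_trans _ _ ((`|m'| + 1) * (d / (2 * (`|m'| + 1))))).
      by rewrite ler_pM ?lerDl ?(ltW g0) // !ge_min lexx !orbT.
    by rewrite le_eqVlt; apply/orP; left; apply/eqP; field; rewrite gt_eqF.
have [s0 s0E] : exists s0, s0 = t1 + g by exists (t1 + g).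
have s0g : s0 - t1 = g by rewrite s0E addrAC subrr add0r.
have s01 : t1 < s0 by rewrite s0E ltrDl.
have s02 : s0 < t2.
  rewrite s0E -ltrBrDl -TE (le_lt_trans gT) //.
  by rewrite ltr_pdivrMr // mulr_natr mulr2n ltrDl.
have Is0 : I s0 by apply: It; exact: ltW.
have fs0 : w t2 x0 + m' * t2 + 2 * d <= w s0 x0 + m' * s0.
  have h1 : `|w s0 x0 - w t1 x0| <= d / 2.
    by rewrite !wE -mulrBr normrM nsg mul1r; apply: Hd1 => //; rewrite s0g gtr0_norm.
  have h2 : - (m' * g) <= d / 2.
    apply: le_trans gm; rewrite -[X in _ <= _ * X](gtr0_norm g0).
    by rewrite -normrM -normrN ler_norm.
  move: h1; rewrite ler_distl => /andP[h1 _]; rewrite s0E mulrDr -s0E.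
  move: f12 h1 h2; move: (w t1 x0) (w t2 x0) (w s0 x0) (m' * t1) (m' * t2) (m' * g).
  by clear; move=> *; lra.
have [kap kap0 kapE] : exists2 kap, 0 < kap & kap / (s0 - t1) = d / 2.
  by exists (d / 2 * g); [rewrite mulr_gt0|rewrite s0g mulfK // gt_eqF].
have [rr [rr0 rrad rrL]] : exists rr, [/\ 0 < rr, rr <= rad & L * rr <= d].
  have L1 : 0 < L + 1 by rewrite ltr_wpDl.
  exists (Num.min rad (d / (L + 1))).
  have rr0 : 0 < Num.min rad (d / (L + 1)) by rewrite lt_min rad0 divr_gt0.
  split => //; first by rewrite ge_min lexx.
  apply: (@le_trans _ _ ((L + 1) * (d / (L + 1)))).
    by rewrite ler_pM ?lerDl ?(ltW rr0) // ge_min lexx orbT.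
  by rewrite mulrC divfK // gt_eqF.
have [Z ZE] : exists Z, Z = 2 * C + `|m'| * T + d by exists (2 * C + `|m'| * T + d).
have Z0 : 0 < Z by rewrite ZE ltr_wpDl // addr_ge0 // mulr_ge0 // ltW.
have [k k0 kE] : exists2 k, 0 < k & k * rho rr = Z.
  by exists (Z / rho rr); [rewrite divr_gt0 // rho_gt0|rewrite divfK // gt_eqF // rho_gt0].
have krho_ge0 y : 0 <= k * rho y.
  by rewrite mulr_ge0 ?(ltW k0) //; have /andP[] := rho01 y.
have krho_le y : k * rho y <= k.
  by rewrite ler_piMr ?(ltW k0) //; have /andP[] := rho01 y.
have kap_ge0 s : t1 < s -> 0 <= kap / (s - t1).
  by move=> s1; rewrite divr_ge0 ?(ltW kap0) // subr_ge0 ltW.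
pose Phi s y := w s y + m' * s - kap / (s - t1) - k * rho (y - x0).
have Phi0 : Phi s0 x0 = w s0 x0 + m' * s0 - d / 2.
  by rewrite /Phi subrr rho0 mulr0 subr0 kapE.
have Phi0_lo : w t2 x0 + m' * t2 + 3 / 2 * d <= Phi s0 x0.
  rewrite Phi0; move: fs0; move: (w s0 x0) (w t2 x0) (m' * s0) (m' * t2).
  by clear; move=> *; lra.
(* no competitor where one of the penalties exceeds Z *)
have far s y : t1 < s -> s <= t2 -> Z <= kap / (s - t1) + k * rho (y - x0) ->
    Phi s y < Phi s0 x0.
  move=> s1 s2 Zle.
  have h1 := wC s y (It _ (ltW s1) s2); have h2 := wC s0 x0 Is0.
  have h4 : m' * s - m' * s0 <= `|m'| * T.
    rewrite -mulrBr (le_trans (ler_norm _)) // normrM ler_wpM2l //.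
    rewrite ler_norml TE; apply/andP; split.
      by rewrite opprB lerB // ltW.
    by rewrite lerB // ltW.
  move: h1 h2; rewrite !ler_norml => /andP[h1 h1'] /andP[h2 h2'].
  rewrite Phi0 /Phi; rewrite ZE in Zle.
  move: Zle h1 h1' h2 h2' h4 d0.
  move: (w s y) (w s0 x0) (m' * s) (m' * s0) (kap / _) (k * _) (`|m'| * T).
  by clear; move=> *; lra.
have [eta [eta0 etag etaZ]] : exists eta, [/\ 0 < eta, eta <= g & eta * Z <= kap].
  exists (Num.min g (kap / Z)); split.
  - by rewrite lt_min g0 divr_gt0.
  - by rewrite ge_min lexx.
  - by rewrite -ler_pdivlMr // ge_min lexx orbT.
pose D : set (R * R) := `[t1 + eta, t2] `*` `[x0 - rr, x0 + rr].
have DP s y : t1 + eta <= s -> s <= t2 -> `|y - x0| <= rr -> D (s, y).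
  move=> s1 s2; rewrite ler_distl => y12.
  by split; rewrite /= in_itv/= ?s1.
have D0 : D (s0, x0).
  apply: DP; first by rewrite s0E lerD2l.
    exact: ltW.
  by rewrite subrr normr0 ltW.
have cD : compact D by apply: compact_setX; exact: segment_compact.
have cPhi : {within D, continuous (unc Phi)}.
  apply/subspace_continuousP => -[s y] Dsy; have [/=] := Dsy.
  rewrite !in_itv/= => /andP[s1 s2] _.
  have Fs : (fun p : R * R => p.1) @ within D (nbhs (s, y)) --> s.
    by apply: cvg_within_filter; exact: cvg_fst.
  have Fy : (fun p : R * R => p.2) @ within D (nbhs (s, y)) --> y.
    by apply: cvg_within_filter; exact: cvg_snd.
  have Fv : (fun p : R * R => v p.1 p.2) @ within D (nbhs (s, y)) --> v s y.
    have [[cv _] _ _] := hv.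
    have DJ : D `<=` (`](- h), (1 + h)]%classic : set R) `*` [set: R].
      move=> -[s' y'] [/=]; rewrite !in_itv/= => /andP[s1' s2'] _; split => //.
      apply/andP; split; last by rewrite (le_trans s2') // (le_trans t21) // lerDl ltW.
      by rewrite (lt_le_trans _ s1') // (lt_le_trans (y := 0)) ?oppr_lt0 // addr_ge0 // ltW.
    by have := continuous_subspaceW DJ cv => /subspace_continuousP/(_ (s, y) Dsy).
  have Fw : (fun p : R * R => w p.1 p.2) @ within D (nbhs (s, y)) --> w s y.
    have -> : (fun p : R * R => w p.1 p.2) = (fun p => sg * v p.1 p.2).
      by apply/funext => p; rewrite wE.
    by rewrite wE; apply: cvgM; [exact: cvg_cst|exact: Fv].
  apply: cvgB; last first.
    apply: cvgM; first exact: cvg_cst.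
    apply: (@cvg_comp _ _ _ (fun p : R * R => p.2 - x0) rho _ (nbhs (y - x0))).
      by apply: cvgB; [exact: Fy|exact: cvg_cst].
    exact: rho_continuous.
  apply: cvgB; last first.
    apply: cvgM; first exact: cvg_cst.
    apply: cvgV; first by rewrite subr_eq0 gt_eqF //=; apply: lt_le_trans s1; rewrite ltrDl.
    by apply: cvgB; [exact: Fs|exact: cvg_cst].
  apply: cvgD; first exact: Fw.
  by apply: cvgM; [exact: cvg_cst|exact: Fs].
have [[t x] /set_mem [/=]] := compact_EVT_max (ex_intro _ _ D0) cD cPhi.
rewrite !in_itv/= => /andP[tt1 tt2]; rewrite -ler_distl => xr Pmax.
have Pmax0 : Phi s0 x0 <= Phi t x by apply: (Pmax (s0, x0)); exact/mem_set.
have t1t : t1 < t by apply: lt_le_trans tt1; rewrite ltrDl.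
have Itt : I t by apply: It => //; exact: ltW.
have Pglob s y : t1 < s -> s <= t2 -> Phi s y <= Phi t x.
  move=> s1 s2.
  have [ss|ss] := ltP s (t1 + eta).
    apply: le_trans Pmax0; apply/ltW/far => //.
    apply: (@le_trans _ _ (kap / (s - t1))); last by rewrite lerDl.
    rewrite ler_pdivlMr ?subr_gt0 // mulrC; apply: le_trans etaZ.
    by rewrite ler_wpM2r ?(ltW Z0) // lerBlDl ltW.
  have [yy|yy] := leP `|y - x0| rr.
    by apply: (Pmax (s, y)); apply/mem_set; exact: DP.
  apply: le_trans Pmax0; apply/ltW/far => //.
  apply: (@le_trans _ _ (k * rho (y - x0))); last by rewrite lerDr kap_ge0.
  rewrite -kE ler_wpM2l ?(ltW k0) //.
  by apply: rho_le; exact: ltW.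
have tlt2 : t < t2.
  rewrite lt_neqAle tt2 andbT; apply/eqP => tE.
  have h2 : w t2 x <= w t2 x0 + d.
    have := wL t2 x x0 It2; rewrite ler_distl => /andP[_ h2].
    by rewrite (le_trans h2) // lerD2l (le_trans _ rrL) // ler_wpM2l.
  move: Pmax0 Phi0_lo h2 (kap_ge0 _ t12) (krho_ge0 (x - x0)) d0; rewrite [Phi t x]/Phi tE.
  move: (Phi s0 x0) (w t2 x) (w t2 x0) (m' * t2) (kap / _) (k * rho _).
  by clear; move=> *; lra.
have [q qE] : exists q, q = t - t1 by exists (t - t1).
have q0 : 0 < q by rewrite qE subr_gt0.
have [A AE] : exists A, A = - m' - kap / q ^+ 2 by exists (- m' - kap / q ^+ 2).
have [del [del0 delq del2]] : exists del, [/\ 0 < del, del <= q / 2 & del <= t2 - t].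
  exists (Num.min (q / 2) (t2 - t)); split.
  - by rewrite lt_min divr_gt0 //= subr_gt0.
  - by rewrite ge_min lexx.
  - by rewrite ge_min lexx orbT.
(* the first term serves near t, the second one where abs (s - t) >= del *)
have [M1 M1E] : exists M1, M1 = 2 * kap / q ^+ 3 by exists (2 * kap / q ^+ 3).
have [M2 M2E] : exists M2, M2 = `|A| / del + (2 * C + k) / del ^+ 2.
  by exists (`|A| / del + (2 * C + k) / del ^+ 2).
have Ck0 : 0 <= 2 * C + k by apply: addr_ge0; [rewrite mulr_ge0|exact: ltW].
have M1_0 : 0 <= M1.
  by rewrite M1E; apply: divr_ge0; [rewrite mulr_ge0 // ltW|rewrite exprn_ge0 // ltW].
have M2_0 : 0 <= M2.
  by rewrite M2E; apply: addr_ge0; apply: divr_ge0; rewrite ?exprn_ge0 ?(ltW del0).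
pose P y := k + - k * zeta (1 * y + - x0).
have CP : Cb 3 P.
  apply: Cb_add; first exact: Cb_cst.
  apply: Cb_mul; first exact: Cb_cst.
  by apply: Cb_affine; have [] := @Cb_zeta_theta R 3.
have PE y : P y = k * rho (y - x0) by rewrite /P mul1r /rho; ring.
have tch s y : I s ->
    w s y <= w t x + (A * (s - t) + (M1 + M2) * (s - t) ^+ 2) + (P y - P x).
  move=> Is; rewrite !PE.
  have sq : 0 <= (s - t) ^+ 2 by exact: sqr_ge0.
  have [del_st|st_del] := leP del `|s - t|.
    have h1 : - (A * (s - t)) <= `|A| / del * (s - t) ^+ 2.
      rewrite (le_trans (ler_norm _)) // normrN normrM -mulrA ler_wpM2l //.
      rewrite ler_pdivlMl // -[leRHS]real_normK ?num_real // expr2.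
      by rewrite ler_wpM2r.
    have h2 : 2 * C + k <= (2 * C + k) / del ^+ 2 * (s - t) ^+ 2.
      rewrite -mulrA; apply: ler_peMr => //.
      rewrite ler_pdivlMl ?exprn_gt0 // mulr1 -[leRHS]real_normK ?num_real //.
      by rewrite lerXn2r ?nnegrE // ltW.
    have h3 : 0 <= M1 * (s - t) ^+ 2 by rewrite mulr_ge0.
    have h4 : w s y <= C by rewrite (le_trans (ler_norm _)) ?wC.
    have h5 : - C <= w t x by rewrite lerNl (le_trans (ler_norm _)) // normrN wC.
    have h6 := krho_ge0 (y - x0); have h7 := krho_le (x - x0).
    rewrite M2E !(mulrDl _ _ ((s - t) ^+ 2)).
    move: h1 h2 h3 h4 h5 h6 h7.
    move: (w s y) (w t x) (M1 * _) (`|A| / del * _) ((2 * C + k) / _ * _) (A * _)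
      (k * rho (y - x0)) (k * rho (x - x0)).
    by clear; move=> *; lra.
  have [st1' s1 s2] : [/\ q / 2 <= s - t1, t1 < s & s <= t2].
    move: st_del; rewrite ltr_norml => /andP[st1 st2].
    move: st1 st2 delq del2 q0 qE; clear; move=> *; split; lra.
  have := Pglob s y s1 s2; rewrite /Phi -qE.
  have := inv_parabola q0 st1'.
  have -> : s - t1 - q = s - t by rewrite qE; ring.
  move=> /(ler_wpM2l (ltW kap0)).
  have -> : kap * (q^-1 - (s - t) / q ^+ 2 + 2 / q ^+ 3 * (s - t) ^+ 2) =
    kap / q - kap / q ^+ 2 * (s - t) + M1 * (s - t) ^+ 2 by rewrite M1E; ring.
  have : 0 <= M2 * (s - t) ^+ 2 by rewrite mulr_ge0.
  rewrite (mulrDl M1 M2).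
  have -> : A * (s - t) = - (m' * s - m' * t) - kap / q ^+ 2 * (s - t).
    by rewrite AE mulrBl mulNr -mulrBr.
  move: (w s y) (w t x) (m' * s) (m' * t) (M1 * _) (M2 * _) (kap / q ^+ 2 * _) (kap / q)
    (kap / (s - t1)) (k * rho (y - x0)) (k * rho (x - x0)).
  by clear; move=> *; lra.
have te := vell _ x (ltW (le_lt_trans t10 t1t)) (le_trans tt2 t21).
have tch' s y : I s -> sg * v s y <=
    sg * v t x + (A * (s - t) + (M1 + M2) * (s - t) ^+ 2) + (P y - P x).
  by rewrite -!wE; exact: tch.
have := touching_slope al1 al2 lam0 lamLam KmI KpI hv vC vL vT sgE Itt CP tch' te.
have := ellm t x (ltW t1t) tt2 (le_trans xr rrad).
have : 0 <= kap / q ^+ 2 by rewrite divr_ge0 ?exprn_ge0 // ltW.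
move: mm'; rewrite AE; move: (kap / _) (sg * _).
by clear; move=> *; lra.
Qed.

(** * Consistency of the random walk with the equation *)

Section Consistency.
Context {R : realType} (al lam Lam : R) (Km Kp : set R).
Hypothesis al1 : 1 < al.
Hypothesis al2 : al < 2.
Hypothesis lam0 : 0 < lam.
Hypothesis lamLam : lam < Lam.
Hypothesis KmI : Km `<=` `]lam, Lam[.
Hypothesis KpI : Kp `<=` `]lam, Lam[.
Context (h : R) (psi : R -> R) (v : R -> R -> R).
Notation I := (`](- h), (1 + h)[%classic : set R).
Hypothesis h0 : 0 < h.
Hypothesis hv : backward_solution al Km Kp h psi v.
Context (C L : R).
Hypothesis vC : forall s y, I s -> `|v s y| <= C.
Hypothesis L0 : 0 <= L.
Hypothesis vL : forall s x y, I s -> `|v s x - v s y| <= L * `|x - y|.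
Hypothesis vT : forall e : R, 0 < e -> exists2 d : R, 0 < d &
  forall s t x, I s -> I t -> `|s - t| < d -> `|v s x - v t x| <= e.
Context (S : sublinear_space R) (Y : nat -> sOmega S -> R) (B : nat -> R).
Hypothesis HY : forall i, sH (Y i).
Hypothesis iidY : iid_seq Y.
Hypothesis Y0 : sE (Y 0%N) = 0.
Hypothesis NY0 : sE (fun w => - Y 0%N w) = 0.
Hypothesis hc : forall e : R, 0 < e ->
  \forall n \near \oo, forall t x : R, 0 <= t -> t <= 1 ->
    (n%:R%:E * `| (sE (fun w => delta (v t) x (B n * Y 0%N w)))%:E
      - (n%:R^-1)%:E * levy_sup al Km Kp (v t) x | < e%:E)%E.

Let inI t : 0 <= t -> t <= 1 -> I t.
Proof. by move=> t0 t1; rewrite /= in_itv/=; apply/andP; split; have := h0; lra. Qed.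

Lemma v_CbLip t : 0 <= t -> t <= 1 -> CbLip (v t).
Proof.
move=> t0 t1; have It := inI t0 t1; apply/CbLipP; split.
  by exists C => x; exact: vC.
by exists L => // x y; exact: vL.
Qed.

(** Since Y has no mean uncertainty, the linear term of the increment is
    invisible to the expectation, whatever its slope. *)
Lemma sE_delta t x n : 0 <= t -> t <= 1 ->
  sE (fun w => delta (v t) x (B n * Y 0%N w)) = step Y (B n) (v t) x - v t x.
Proof.
move=> t0 t1; have Cv := v_CbLip t0 t1.
have HZ := sH_step (B n) HY x 0 Cv.
rewrite /step -(sE_add_cst (- v t x) HZ).
rewrite -(@sE_add_centered R S (fun w => v t (x + B n * Y 0%N w) + - v t x) (Y 0%N)
  (- (derive1 (v t) x * B n)) (sH_add HZ (sH_cst S _)) (HY 0) Y0 NY0).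
by congr sE; apply/funext => w; rewrite /delta; ring.
Qed.

Definition ell t x : R := fine (levy_sup al Km Kp (v t) x).

(** An infinite value of the operator would make the consistency error
    infinite. *)
Lemma levy_supE t x : 0 <= t -> t <= 1 -> levy_sup al Km Kp (v t) x = (ell t x)%:E.
Proof.
move=> t0 t1; have [N _ HN] := hc ltr01.
have := HN N.+1 (leqnSn N) t x t0 t1; rewrite /ell.
case: levy_sup => [r //| |].
- rewrite gt0_muley ?lte_fin ?invr_gt0 //= gt0_muley ?lte_fin //.
- rewrite gt0_muleNy ?lte_fin ?invr_gt0 //= gt0_muley ?lte_fin //.
Qed.

Lemma consistency e : 0 < e -> exists2 N : nat, (0 < N)%N &
  forall n t x, (N <= n)%N -> 0 <= t -> t <= 1 ->
    `|n%:R * (step Y (B n) (v t) x - v t x) - ell t x| <= e.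
Proof.
move=> e0; have [N _ HN] := hc e0.
exists N.+1 => // n t x Nn t0 t1.
have n0 : 0 < n%:R :> R by rewrite ltr0n (leq_trans _ Nn).
have := HN n (ltnW Nn) t x t0 t1.
rewrite levy_supE // sE_delta // -EFinM lte_fin => H.
set a := step _ _ _ _ - _ in H *.
have -> : n%:R * a - ell t x = n%:R * (a - n%:R^-1 * ell t x).
  by field; rewrite gt_eqF.
by rewrite normrM (gtr0_norm n0) ltW.
Qed.

(** The operator applied to v is the uniform limit of the difference operators
    n (E [v (x + B Y)] - v (x)), each of which inherits the modulus of continuity
    of v, multiplied by 2 n. *)
Lemma ell_uniformly_continuous e : 0 < e -> exists2 d, 0 < d &
  forall s t x y, 0 <= s -> s <= 1 -> 0 <= t -> t <= 1 ->
    `|s - t| < d -> `|x - y| < d -> `|ell s x - ell t y| <= e.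
Proof.
move=> e0; have e3 : 0 < e / 3 by rewrite divr_gt0.
have [N N0 HN] := consistency e3.
have N0R : 0 < N%:R :> R by rewrite ltr0n.
pose e' := e / (12 * N%:R).
have e'0 : 0 < e' by rewrite divr_gt0 // mulr_gt0.
have [d d0 Hd] := vT e'0.
have L1 : 0 < L + 1 by rewrite ltr_wpDl.
exists (Num.min d (e' / (L + 1))) => [|s t x y s0 s1 t0 t1].
  by rewrite lt_min d0 divr_gt0.
rewrite !lt_min => /andP[st _] /andP[_ xy].
have h1 := HN N s x (leqnn N) s0 s1; have h2 := HN N t y (leqnn N) t0 t1.
have vv z z' : z - z' = x - y -> `|v s z - v t z'| <= 2 * e'.
  move=> zz; rewrite (le_trans (ler_distD (v s z') _ _)) // mulr_natl mulr2n lerD //.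
    rewrite (le_trans (vL _ _ (inI s0 s1))) // zz.
    apply: (@le_trans _ _ ((L + 1) * (e' / (L + 1)))).
      by rewrite ler_pM // ?lerDl // ltW.
    by rewrite mulrC divfK // gt_eqF.
  by apply: Hd => //; exact: inI.
have hst : `|step Y (B N) (v s) x - step Y (B N) (v t) y| <= 2 * e'.
  apply: (sE_dist_cst (sH_step _ HY x 0 (v_CbLip s0 s1))
    (sH_step _ HY y 0 (v_CbLip t0 t1))).
  by move=> w; apply: vv; ring.
have hv' : `|v s x - v t y| <= 2 * e' by exact: vv.
have hN : `|N%:R * (step Y (B N) (v s) x - v s x) - N%:R * (step Y (B N) (v t) y - v t y)|
    <= e / 3.
  rewrite -mulrBr normrM (gtr0_norm N0R).
  have -> : e / 3 = N%:R * (4 * e') by rewrite /e'; field; rewrite gt_eqF.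
  rewrite ler_wpM2l ?(ltW N0R) //.
  have -> : step Y (B N) (v s) x - v s x - (step Y (B N) (v t) y - v t y) =
    (step Y (B N) (v s) x - step Y (B N) (v t) y) - (v s x - v t y) by ring.
  have -> : 4 * e' = 2 * e' + 2 * e' by ring.
  by rewrite (le_trans (ler_normB _ _)) // lerD.
move: h1 h2 hN; move: (N%:R * _) (N%:R * _) (ell s x) (ell t y) => a2 a1 b1 b2 h1 h2 hN.
have -> : b1 - b2 = (a1 - a2) - (a1 - b1) + (a2 - b2) by ring.
rewrite (le_trans (ler_normD _ _)) // (le_trans (lerD (ler_normB _ _) (lexx _))) //.
by rewrite (le_trans (lerD (lerD hN h1) h2)) // le_eqVlt; apply/orP; left; apply/eqP; field.
Qed.

(** Where ell is within e of its value at (t2, x), the comparisons for v and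
    for - v bound the increment of v from both sides. *)
Lemma time_derivative e : 0 < e -> exists2 d, 0 < d &
  forall t1 t2 x, 0 <= t1 -> t1 < t2 -> t2 <= 1 -> t2 - t1 < d ->
    `|v t1 x - v t2 x - ell t2 x * (t2 - t1)| <= e * (t2 - t1).
Proof.
move=> e0; have [d d0 Hd] := ell_uniformly_continuous e0.
exists d => // t1 t2 x t10 t12 t21 td.
have near_t2 t y : t1 <= t -> t <= t2 -> `|y - x| <= d / 2 -> `|ell t y - ell t2 x| <= e.
  move=> tt1 tt2 yx; apply: Hd; try lra.
  by rewrite distrC ger0_norm ?subr_ge0 //; lra.
have bound sg : sg = 1 \/ sg = -1 ->
    sg * v t1 x - sg * v t2 x <= (sg * ell t2 x + e) * (t2 - t1).
  move=> sgE.
  have d2 : 0 < d / 2 by rewrite divr_gt0.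
  apply: (time_comparison al1 al2 lam0 lamLam KmI KpI h0 hv vC vL vT levy_supE
    sgE t10 t12 t21 d2).
  move=> t y tt1 tt2 yx; have := near_t2 t y tt1 tt2 yx.
  move: (ell t y) (ell t2 x) => l1 l2; rewrite ler_norml => /andP[a1 a2].
  by case: sgE => ->; lra.
have := bound 1 (or_introl erefl); have := bound (-1) (or_intror erefl).
move: (ell t2 x) (v t1 x) (v t2 x) (t2 - t1) => l v1 v2 D.
by rewrite !mulN1r !mul1r !mulrDl mulNr ler_norml => b1 b2; apply/andP; split; lra.
Qed.

(** Over a time step 1/n, the walk and the equation both change v by ell / n up
    to o (1/n), and there are n steps. *)
Lemma walk_limit e : 0 < e -> \forall n \near \oo,
  `|sE (fun w => v 1 (B n * \sum_(i < n) Y i w)) - v 0 0| <= e.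
Proof.
move=> e0; have e2 : 0 < e / 2 by rewrite divr_gt0.
have [N N0 HN] := consistency e2; have [d d0 Hd] := time_derivative e2.
have : \forall n \near \oo, (n.+1%:R^-1 < d :> R).
  exact: near_infty_natSinv_lt (PosNum d0).
move=> [N1 _ HN1]; near=> n.
have Nn : (N <= n)%N by near: n; exact: nbhs_infty_ge.
have N1n : (N1 < n)%N by near: n; exact: nbhs_infty_gt.
have n0 : (0 < n)%N by exact: leq_trans N0 Nn.
have nR : 0 < n%:R :> R by rewrite ltr0n.
have nd : n%:R^-1 < d.
  by have := HN1 n.-1; rewrite prednK //; apply; rewrite /= -ltnS prednK.
pose tau (k : nat) : R := Num.min (k%:R / n%:R) 1.
have tau0 k : 0 <= tau k by rewrite le_min ler01 divr_ge0.
have tau1 k : tau k <= 1 by rewrite ge_min lexx orbT.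
have tauE k : (k <= n)%N -> tau k = k%:R / n%:R.
  by move=> kn; rewrite /tau min_l // ler_pdivrMr // mul1r ler_nat.
have Vstep k x : (k < n)%N -> `|step Y (B n) (v (tau k.+1)) x - v (tau k) x| <= e / n%:R.
  move=> kn.
  have tt : tau k.+1 - tau k = n%:R^-1.
    by rewrite !tauE // ?(ltnW kn) // -natr1 mulrDl mul1r addrAC subrr add0r.
  have h1 := HN n (tau k.+1) x Nn (tau0 _) (tau1 _).
  have h2 : `|v (tau k) x - v (tau k.+1) x - ell (tau k.+1) x / n%:R| <= e / 2 / n%:R.
    rewrite -tt; apply: Hd => //; last by rewrite tt.
    by rewrite -subr_gt0 tt invr_gt0.
  set st := step _ _ _ _ in h1 *.
  have h3 : `|st - v (tau k.+1) x - ell (tau k.+1) x / n%:R| <= e / 2 / n%:R.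
    rewrite ler_pdivlMr // -[X in _ * X <= _](gtr0_norm nR) -normrM.
    have -> // : (st - v (tau k.+1) x - ell (tau k.+1) x / n%:R) * n%:R =
      n%:R * (st - v (tau k.+1) x) - ell (tau k.+1) x.
    by field; rewrite gt_eqF.
  have -> : st - v (tau k) x = (st - v (tau k.+1) x - ell (tau k.+1) x / n%:R) -
    (v (tau k) x - v (tau k.+1) x - ell (tau k.+1) x / n%:R) by ring.
  by rewrite (le_trans (ler_normB _ _)) // (le_trans (lerD h3 h2)) // -mulrDl; lra.
have := walk_telescope HY iidY (V := fun k => v (tau k))
  (fun k => v_CbLip (tau0 k) (tau1 k)) Vstep.
have -> : tau n = 1 by rewrite tauE // divff // gt_eqF.
have -> : tau 0%N = 0 by rewrite tauE // mul0r.
by rewrite [leRHS]mulrC divfK // gt_eqF.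
Unshelve. all: by end_near. Qed.

End Consistency.

(** * The limit theorem *)

Unset Implicit Arguments.

(* [Y i] is the (i+1)-st variable of the sequence.  As [sE] is real-valued on
   [sH], finiteness of the expectation of |Y_1| is membership of |Y_1| in [sH].
   In the last hypothesis, [v] ranges over the viscosity solutions of the
   backward equation, of which there is exactly one on (-h, 1 + h] x R. *)
Theorem theorem3p1 (R : realType) (alpha lambda Lambda : R)
  (halpha1 : 1 < alpha) (halpha2 : alpha < 2)
  (hlambda : 0 < lambda) (hLambda : lambda < Lambda)
  (Km Kp : set R)
  (hKm0 : Km !=set0) (hKp0 : Kp !=set0)
  (hKmb : bounded_set Km) (hKpb : bounded_set Kp)
  (hKmm : measurable Km) (hKpm : measurable Kp)
  (hKm : Km `<=` `]lambda, Lambda[) (hKp : Kp `<=` `]lambda, Lambda[)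
  (S : sublinear_space R) (X : R -> sOmega S -> R)
  (hX : nonlinear_stable_levy alpha Km Kp X)
  (S' : sublinear_space R) (Y : nat -> sOmega S' -> R)
  (hYH : forall i, sH (Y i)) (hY : iid_seq Y)
  (b : R) (hb : 0 < b)
  (h_i : sE (Y 0%N) = 0 /\ sE (fun w => - Y 0%N w) = 0)
  (h_ii : sH (fun w => `|Y 0%N w|))
  (h_iii : forall (h : R) (psi : R -> R), 0 < h -> h < 1 -> CbLip psi ->
     forall v : R -> R -> R, backward_solution alpha Km Kp h psi v ->
     forall e : R, 0 < e ->
     \forall n \near \oo, forall t x : R, 0 <= t -> t <= 1 ->
       (n%:R%:E *
        `| (sE (fun w => delta (v t) x ((b * n%:R `^ alpha^-1)^-1 * Y 0%N w)))%:E
           - (n%:R^-1)%:E * levy_sup alpha Km Kp (v t) x | < e%:E)%E)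
  (psi : R -> R) (hpsi : CbLip psi) :
  sE (fun w => psi ((b * n%:R `^ alpha^-1)^-1 * \sum_(i < n) Y i w))
    @[n --> \oo] --> sE (fun w => psi (X 1 w)).
Proof.
have [Y00 NY00] := h_i.
have [C C0 uC] := flow_bounded hX hpsi.
have [L L0 uL] := flow_lipschitz hX hpsi.
have uT := flow_time_continuous hX hpsi.
have -> : sE (fun w => psi (X 1 w)) = flow X psi 1 0.
  by rewrite /flow; congr sE; apply/funext => w; rewrite add0r.
pose B (n : nat) := (b * n%:R `^ alpha^-1)^-1.
apply/cvgrPdist_le => e e0.
have e4 : 0 < e / 4 by rewrite divr_gt0.
have [d d0 Hd] := uT _ e4.
pose h := Num.min (d / 2) (1 / 2).
have h0 : 0 < h by rewrite lt_min !divr_gt0.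
have h1 : h < 1 by rewrite gt_min; apply/orP; right; lra.
have hd : h < d by rewrite gt_min; apply/orP; left; lra.
pose v t x := flow X psi (1 + h - t) x.
have [fwd _] := nsl_pde hX hpsi.
have hv : backward_solution alpha Km Kp h psi v by exact: time_reversal fwd.
have It t : (`](- h), (1 + h)[%classic : set R) t -> 0 <= 1 + h - t.
  by rewrite /= in_itv/= => /andP[_ t1]; rewrite subr_ge0 ltW.
have vC s y : (`](- h), (1 + h)[%classic : set R) s -> `|v s y| <= C.
  by move=> /It s0; exact: uC.
have vL s x y : (`](- h), (1 + h)[%classic : set R) s -> `|v s x - v s y| <= L * `|x - y|.
  by move=> /It s0; exact: uL.
have vT (r : R) : 0 < r -> exists2 q : R, 0 < q & forall s t x,
    (`](- h), (1 + h)[%classic : set R) s -> (`](- h), (1 + h)[%classic : set R) t ->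
    `|s - t| < q -> `|v s x - v t x| <= r.
  move=> r0; have [q q0 Hq] := uT r r0; exists q => // s t x /It s0 /It t0 st.
  apply: Hq => //; have -> : 1 + h - s - (1 + h - t) = t - s by ring.
  by rewrite distrC.
have hc r (r0 : 0 < r) := h_iii h psi h0 h1 hpsi v hv r r0.
have wl := walk_limit halpha1 halpha2 hlambda hLambda hKm hKp h0 hv vC L0 vL vT
  (B := B) hYH hY Y00 NY00 hc e4.
near=> n.
have wn : `|sE (fun w => v 1 (B n * \sum_(i < n) Y i w)) - v 0 0| <= e / 4.
  by near: n; exact: wl.
have HW : sH (fun w => B n * \sum_(i < n) Y i w) by apply: sH_scale; exact: sH_sum.
have v1E x : v 1 x = flow X psi h x by rewrite /v addrAC subrr add0r.
have psi_v : `|sE (fun w => psi (B n * \sum_(i < n) Y i w)) -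
    sE (fun w => v 1 (B n * \sum_(i < n) Y i w))| <= e / 4.
  apply: sE_dist_cst.
  - exact: sH_comp.
  - apply: sH_comp => //; apply/CbLipP; split.
      by exists C => x; rewrite v1E uC // ltW.
    by exists L => // x y; rewrite !v1E uL // ltW.
  - move=> w; rewrite v1E -[psi _](flow0 hX psi).
    by apply: Hd; rewrite ?lexx ?(ltW h0) // sub0r normrN gtr0_norm.
have u_v : `|flow X psi 1 0 - v 0 0| <= e / 4.
  rewrite /v subr0; apply: Hd; rewrite ?ler01 ?addr_ge0 ?(ltW h0) //.
  by rewrite opprD addrA subrr sub0r normrN gtr0_norm.
move: wn psi_v u_v; rewrite -/(B n).
move: (sE _) (sE _) (flow _ _ _ _) (v 0 0) => x1 x2 x3 x4; clear -e0.
rewrite !ler_norml => /andP[a1 a2] /andP[b1 b2] /andP[c1 c2].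
by apply/andP; split; lra.
Unshelve. all: by end_near. Qed.
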